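(* Let $\nu\in\mathcal M^1$ be a probability measure, let $(X,Y)$ be a $\nu$-decomposable pair with null $\sigma$-ideal $\Xi=\{A\in\mathcal F:\forall\mu\in X,\ |\mu|(A)=0\}$, and write $X^1=X\cap\mathcal M^1$. For $g\in Y$ define the optimal lower bound function $$\mathscr L(\varepsilon)=\inf\Big\{D_\varphi(\mu\|\nu):\mu\in X^1,\ \int g\,d\mu-\int g\,d\nu=\varepsilon\Big\},\qquad\varepsilon\in\mathbb R,\quad(\inf\emptyset=+\infty).$$ Then for every $g\in Y$ and every $\varepsilon$ in the interior of $\operatorname{dom}\mathscr L=\{\varepsilon\in\mathbb R:\mathscr L(\varepsilon)<+\infty\}$, $$\mathscr L(\varepsilon)=K_{g,\nu,\Xi}^\star(\varepsilon),$$ where $K_{g,\nu,\Xi}^\star$ is the convex conjugate of the cumulant generating function $K_{g,\nu,\Xi}$. Furthermore, if $\mathscr L$ is lower semicontinuous (equivalently, if strong duality holds, for every $\varepsilon\in\mathbb R$, in the minimization problem defining $\mathscr L(\varepsilon)$), then $\mathscr L(\varepsilon)=K_{g,\nu,\Xi}^\star(\varepsilon)$ for all $\varepsilon\in\mathbb R$.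
   Context: $(\Omega,\mathcal F)$ is a measurable space with $\{\emptyset,\Omega\}\subsetneq\mathcal F$; $\mathcal M,\mathcal M^+,\mathcal M^1$ are the sets of finite signed measures, finite non-negative measures and probability measures on it. $\mathcal M_c(\nu)=\{\mu\in\mathcal M:\mu\ll\nu\}$. For a $\sigma$-ideal $\Xi\subseteq\mathcal F$, $L^0(\Xi)$ is the space of real measurable functions modulo equality outside an element of $\Xi$; $\operatorname{ess\,im}_\Xi f=\bigcap_{\epsilon>0}\{x\in\mathbb R: f^{-1}((x-\epsilon,x+\epsilon))\notin\Xi\}$, $\operatorname{ess\,sup}_\Xi f=\sup\operatorname{ess\,im}_\Xi f$, and $L^\infty(\Xi)$ is the space of functions with bounded $\Xi$-essential range. Standing assumptions on $\varphi$: $\varphi:\mathbb R\to[0,+\infty]$ is convex, lower semicontinuous, $\varphi(1)=0$ (so $1$ is a global minimizer), $\varphi(x)=+\infty$ for $x<0$, and $\operatorname{dom}\varphi$ contains a neighborhood of $1$. $\varphi'(\pm\infty)=\lim_{x\to\pm\infty}\varphi(x)/x$. Set $\psi(x)=\varphi(x+1)$. The convex conjugate of $f:\mathbb R\to\overline{\mathbb R}$ is $f^\star(y)=\sup_x\{xy-f(x)\}$. For $\mu\in\mathcal M$, $\nu\in\mathcal M^+$ with Lebesgue decomposition $\mu=\mu_c+\mu_s$ ($\mu_c\ll\nu$, $\mu_s\perp\nu$) and Hahn–Jordan decomposition $\mu_s=\mu_s^+-\mu_s^-$, $D_\varphi(\mu\|\nu)=\int\varphi(\frac{d\mu_c}{d\nu})d\nu+\mu_s^+(\Omega)\varphi'(\infty)-\mu_s^-(\Omega)\varphi'(-\infty)$,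 with $0\cdot(\pm\infty)=0$. Cumulant generating function: for $\nu\in\mathcal M^1$ vanishing on $\Xi$ and $g\in L^0(\Xi)$, $$K_{g,\nu,\Xi}(t)=\inf\Big\{\int\psi^\star(tg+\lambda)\,d\nu:\lambda\in\mathbb R,\ \lambda+\operatorname{ess\,sup}_\Xi(tg)\le\varphi'(\infty)\Big\},\quad t\in\mathbb R.$$ Strong duality at $\varepsilon$ means $\mathscr L(\varepsilon)=\sup_{t\in\mathbb R}\{t\varepsilon-\Phi^\star(tg)\}$, where $\Phi^\star(h)=\sup_{\mu\in X^1}\{\int h\,d\mu-\int h\,d\nu-D_\varphi(\mu\|\nu)\}$ for $h\in Y$. Decomposability: let $X\subseteq\mathcal M$ be a vector space of finite signed measures with null $\sigma$-ideal $\Xi=\{A\in\mathcal F:\forall\mu\in X,|\mu|(A)=0\}$, $Y$ a vector space of measurable functions, $\nu\in X\cap\mathcal M^+$. The pair $(X,Y)$ is $\nu$-decomposable if (1) the pairing $(\mu,h)\mapsto\int h\,d\mu$ is well defined and puts $X$ and $Y$ in separating duality; (2) $\{\mu\in\mathcal M_c(\nu): d\mu/d\nu\in L^\infty(\nu)\}\subseteq X$ and $L^\infty(\Xi)\subseteq Y\subseteq L^0(\Xi)$; (3) for every $A\in\mathcal F\setminus\Xi$ there is a nonzero $\mu\in X\cap\mathcal M^+$ with $\mu(\Omega\setminus A)=0$. *)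

(* Defs.v *)
From HB Require Import structures.
From mathcomp Require Import all_boot all_order all_algebra.
From mathcomp Require Import all_classical all_reals all_analysis.
Import Order.TTheory GRing.Theory Num.Theory.
Import numFieldNormedType.Exports.

Set Implicit Arguments.
Unset Strict Implicit.
Unset Printing Implicit Defensive.

Local Open Scope classical_set_scope.
Local Open Scope ring_scope.
Local Open Scope ereal_scope.
Local Open Scope charge_scope.

(* A finite signed measure is a [{charge set T -> \bar R}]. The value of a
   charge at a non-measurable set is arbitrary, so two charges denote the same
   signed measure when they agree on the measurable sets ([charge_eq]). *)
Section signed_measures.
Context d (T : measurableType d) (R : realType).
Implicit Types (mu : {charge set T -> \bar R})
  (nu : {finite_measure set T -> \bar R}).

Definition charge_eq mu1 mu2 := forall A, measurable A -> mu1 A = mu2 A.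

Let hahn mu := cid (Hahn_decomposition mu).

Definition hahn_posset mu : set T := projT1 (hahn mu).

Definition hahn_negset mu : set T := projT1 (cid (projT2 (hahn mu))).

Definition hahnP mu : hahn_decomposition mu (hahn_posset mu) (hahn_negset mu) :=
  projT2 (cid (projT2 (hahn mu))).

Definition charge_pos mu : {finite_measure set T -> \bar R} :=
  jordan_pos (hahnP mu).

Definition charge_neg mu : {finite_measure set T -> \bar R} :=
  jordan_neg (hahnP mu).

Definition total_variation mu : {measure set T -> \bar R} :=
  charge_variation (hahnP mu).

(* Meaningful when [h] is integrable with respect to [total_variation mu]. *)
Definition charge_integral mu (h : T -> R) : R :=
  (\int[charge_pos mu]_x h x - \int[charge_neg mu]_x h x)%R.

Definition mutually_singular mu nu := exists N : set T,
  [/\ measurable N, nu N = 0 & total_variation mu (~` N) = 0].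

Definition lebesgue_decomposition mu nu (mc ms : {charge set T -> \bar R}) :=
  [/\ charge_eq mu (cadd mc ms), mc `<< nu & mutually_singular ms nu].

Lemma total_variation_fin mu A : measurable A ->
  total_variation mu A \is a fin_num.
Proof.
move=> mA; rewrite /total_variation/= /charge_variation.
by rewrite fin_numD !fin_num_measure.
Qed.

Lemma abse_le_total_variation mu A : measurable A ->
  `|mu A| <= total_variation mu A.
Proof. exact: abse_charge_variation. Qed.

Lemma total_variation_crestr mu (D : set T) (mD : measurable D) A :
  measurable A -> A `&` D = set0 -> total_variation (crestr mu mD) A = 0.
Proof.
move=> mA AD0; rewrite /total_variation/= /charge_variation.
have [[mP _] [mN _] _ _] := hahnP (crestr mu mD).
have H B : measurable B -> crestr mu mD (A `&` B) = 0.
  by move=> mB; rewrite /crestr/= setIAC AD0 set0I charge0.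
rewrite jordan_posE cjordan_posE jordan_negE cjordan_negE /crestr0.
rewrite !mem_set//=.
rewrite [X in X + _ = _](_ : _ = 0) ?[X in _ + X = _](_ : _ = 0) ?adde0//.
  by rewrite [X in - X](_ : _ = 0) ?oppe0//; exact: (H _ mN).
exact: (H _ mP).
Qed.

Lemma lebesgue_decomposition_ex mu nu :
  exists mc ms, lebesgue_decomposition mu nu mc ms.
Proof.
pose m := total_variation mu.
pose S := [set m A | A in [set A | measurable A /\ nu A = 0]].
have S0 : S !=set0 by exists (m set0), set0.
have sfin : ereal_sup S \is a fin_num.
  rewrite ge0_fin_numE.
    apply: (@le_lt_trans _ _ (m setT)); last first.
      by rewrite -ge0_fin_numE//; exact: total_variation_fin.
    apply: ge_ereal_sup => _ [A [mA _] <-].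
    by apply: le_measure => //; rewrite inE.
  by apply: (le_trans (measure_ge0 m set0)); apply: ereal_sup_ubound; exists set0.
have /choice[F FP] n : exists A, [/\ measurable A, nu A = 0 &
    ereal_sup S - (n.+1%:R^-1)%:E < m A].
  have n0 : (0 < n.+1%:R^-1 :> R)%R by rewrite invr_gt0.
  have [_ [A [mA A0] <-] lt] := ub_ereal_sup_adherent n0 sfin.
  by exists A.
pose N := \bigcup_n F n.
have mN : measurable N by apply: bigcup_measurable => n _; have [] := FP n.
have nuN : nu N = 0.
  apply/(@negligibleP _ _ _ nu _ mN).
  apply: (@negligible_bigcup _ _ _ nu) => n.
  by have [mF F0 _] := FP n; exists (F n); split => // x.
have mFN n : m (F n) <= m N.
  by apply: le_measure; rewrite ?inE//; [have [] := FP n|exact: bigcup_sup].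
have sN : ereal_sup S <= m N.
  apply/lee_addgt0Pr => e e0.
  have [n ne] : exists n, (n.+1%:R^-1 < e)%R.
    by exists (Num.truncn e^-1); rewrite invf_plt ?posrE// truncnS_gt.
  have [_ _ lt] := FP n.
  rewrite -leeBlDr//; apply: le_trans (mFN n); apply: le_trans (ltW lt).
  by apply: leeB => //; rewrite lee_fin ltW.
have mNC : measurable (~` N) by exact: measurableC.
exists (crestr mu mNC), (crestr mu mN); split.
- move=> A mA; rewrite [RHS]addeC.
  by apply: charge_partition; rewrite ?setUv ?setICr.
- apply/null_content_dominatesP => A mA A0.
  rewrite /crestr/=; pose B := A `&` ~` N.
  have mB : measurable B by exact: measurableI.
  have nuB : nu B = 0.
    apply/eqP; rewrite eq_le measure_ge0 andbT -A0.
    by apply: le_measure; rewrite ?inE//; exact: subIsetl.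
  have NB0 : N `&` B = set0 by rewrite /B setIA setIAC setICr set0I.
  have : m (N `|` B) <= m N.
    apply: le_trans sN; apply: ereal_sup_ubound; exists (N `|` B) => //.
    split; first exact: measurableU.
    by apply/eqP; rewrite measureU//= nuN nuB adde0.
  rewrite measureU// -leeBrDl ?total_variation_fin// subee ?total_variation_fin//.
  move=> mB0; apply/eqP; rewrite -abse_eq0 eq_le abse_ge0 andbT.
  exact: le_trans (abse_le_total_variation mu mB) mB0.
- exists N; split => //; apply: total_variation_crestr => //.
  by rewrite setICl.
Qed.

Let lebesgue mu nu := cid (lebesgue_decomposition_ex mu nu).

Definition ac_part mu nu : {charge set T -> \bar R} := projT1 (lebesgue mu nu).

Definition sing_part mu nu : {charge set T -> \bar R} :=
  projT1 (cid (projT2 (lebesgue mu nu))).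

Lemma ac_sing_partP mu nu :
  lebesgue_decomposition mu nu (ac_part mu nu) (sing_part mu nu).
Proof. exact: projT2 (cid (projT2 (lebesgue mu nu))). Qed.

End signed_measures.

Section extended_real_functions.
Context (R : realType).
Implicit Types f phi : R -> \bar R.

Definition econvex f := forall (x y t : R), (0 <= t <= 1)%R ->
  f (t * x + (1 - t) * y)%R <= t%:E * f x + (1 - t)%:E * f y.

Definition conjugate f (y : R) : \bar R :=
  ereal_sup [set (x * y)%:E - f x | x in [set: R]].

Definition edom f : set R := [set x | f x < +oo].

Definition slope_pinfty f : \bar R := lim (f x * (x^-1)%:E @[x --> +oo%R]).

Definition slope_ninfty f : \bar R := lim (f x * (x^-1)%:E @[x --> -oo%R]).

Record divergence_generator phi : Prop := {
  dg_ge0 : forall x, 0 <= phi x ;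
  dg_convex : econvex phi ;
  dg_lsc : lower_semicontinuous phi ;
  dg1 : phi 1%R = 0 ;
  dg_neg : forall x : R, (x < 0)%R -> phi x = +oo ;
  dg_dom : \forall x \near (1%R : R), edom phi x }.

Definition recenter phi (x : R) : \bar R := phi (x + 1)%R.

End extended_real_functions.

Section essential_range.
Context d (T : measurableType d) (R : realType).
Implicit Types (Xi : set (set T)) (f : T -> R).

Definition ess_im Xi f : set R :=
  [set x | forall e : R, (0 < e)%R -> ~ Xi (f @^-1` `](x - e)%R, (x + e)%R[%classic)].

Definition ess_sup_ideal Xi f : \bar R := ereal_sup (EFin @` ess_im Xi f).

Definition Linfty_ideal Xi : set (T -> R) :=
  [set f | measurable_fun setT f /\ bounded_set (ess_im Xi f)].

End essential_range.

Section divergence.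
Context d (T : measurableType d) (R : realType).
Implicit Types (phi : R -> \bar R) (mu : {charge set T -> \bar R})
  (nu : {finite_measure set T -> \bar R}) (X : set ({charge set T -> \bar R}))
  (Y : set (T -> R)) (Xi : set (set T)) (g h : T -> R).

(* The sum is never of the form [+oo - oo]: [0 * +oo = 0] in
   [\bar R], and each of the three summands is nonnegative when [phi] is a
   [divergence_generator], [slope_ninfty phi] being then [-oo]. *)
Definition divergence phi mu nu : \bar R :=
  \int[nu]_x phi (fine (('d (ac_part mu nu) '/d nu) x))
  + charge_pos (sing_part mu nu) setT * slope_pinfty phi
  - charge_neg (sing_part mu nu) setT * slope_ninfty phi.

Definition nonneg_charge mu := forall A, measurable A -> 0 <= mu A.

Definition prob_charges X : set ({charge set T -> \bar R}) :=
  [set mu | [/\ X mu, nonneg_charge mu & mu setT = 1]].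

Definition charge_subspace X :=
  [/\ forall mu mu', X mu -> charge_eq mu mu' -> X mu',
      X (czero : {charge set T -> \bar R}),
      forall mu1 mu2, X mu1 -> X mu2 -> X (cadd mu1 mu2)
    & forall (a : R) mu, X mu -> X (cscale a mu)].

(* A space of classes modulo [Xi] is the saturated set of all representatives. *)
Definition fun_subspace Xi Y :=
  [/\ forall h h', Y h -> measurable_fun setT h' ->
        Xi [set x | h x != h' x] -> Y h',
      Y (fun=> 0%R),
      forall h1 h2, Y h1 -> Y h2 -> Y (fun x => h1 x + h2 x)%R
    & forall (a : R) h, Y h -> Y (fun x => a * h x)%R].

Definition null_ideal X : set (set T) :=
  [set A | measurable A /\ forall mu, X mu -> total_variation mu A = 0].

Definition measure_null_ideal nu : set (set T) :=
  [set A | measurable A /\ nu A = 0].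

Definition separating_duality X Y :=
  [/\ forall mu h, X mu -> Y h ->
        (total_variation mu).-integrable setT (EFin \o h),
      forall mu, X mu -> (forall h, Y h -> charge_integral mu h = 0%R) ->
        charge_eq mu (czero : {charge set T -> \bar R})
    & forall h, Y h -> (forall mu, X mu -> charge_integral mu h = 0%R) ->
        null_ideal X [set x | h x != 0%R]].

(* [L^oo(nu)] is [Linfty_ideal] at the ideal of [nu]-null sets. *)
Record decomposable nu X Y : Prop := {
  dec_X : charge_subspace X ;
  dec_Y : fun_subspace (null_ideal X) Y ;
  dec_nu : X (charge_of_finite_measure nu) ;
  dec_duality : separating_duality X Y ;
  dec_density : forall mu, mu `<< nu ->
    Linfty_ideal (measure_null_ideal nu) (fun x => fine (('d mu '/d nu) x)) ->
    X mu ;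
  dec_Linfty : Linfty_ideal (null_ideal X) `<=` Y ;
  dec_measurable : forall h, Y h -> measurable_fun setT h ;
  dec_supported : forall A, measurable A -> ~ null_ideal X A ->
    exists mu, [/\ X mu, nonneg_charge mu,
      ~ charge_eq mu (czero : {charge set T -> \bar R}) & mu (~` A) = 0] }.

Definition opt_lower_bound phi X nu g (e : R) : \bar R :=
  ereal_inf [set divergence phi mu nu | mu in
    [set mu | prob_charges X mu /\
              (charge_integral mu g - \int[nu]_x g x)%R = e]].

Definition cumulant phi Xi nu g (t : R) : \bar R :=
  ereal_inf
    [set \int[nu]_x conjugate (recenter phi) (t * g x + l)%R | l in
      [set l : R | l%:E + ess_sup_ideal Xi (fun x => t * g x)%R
                   <= slope_pinfty phi]].

Definition Phi_star phi X nu h : \bar R :=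
  ereal_sup [set (charge_integral mu h - \int[nu]_x h x)%:E
                 - divergence phi mu nu | mu in prob_charges X].

Definition strong_duality phi X nu g (e : R) :=
  opt_lower_bound phi X nu g e =
  ereal_sup [set (t * e)%:E - Phi_star phi X nu (fun x => t * g x)%R
            | t in [set: R]].

End divergence.

(* Main.v *)
(* Proof idea.  The function [L] is convex and nonnegative, and its conjugate is
   [t |-> Phi_star (t g)]; so everything reduces to one-dimensional
   Fenchel-Moreau duality for [L] and to the identity [Phi_star (t g) = K t].
   The inequality [<=] is Fenchel-Young.  For [>=], put [h = t g]: a supporting
   line of the value function obtained by relaxing the constraint
   [mu setT = 1] gives a real [l] such that, for every nonnegative [mu] in [X],
     int (h + l) dmu - D(mu || nu) <= Phi_star h + int (h + l) dnu.
   Testing this with [nu + n mu], [mu] supported where [h] is close to its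
   essential supremum, shows that [l] is admissible in the infimum defining
   [K t]; testing it with bounded densities that nearly maximize
   [x |-> (x - 1)(h + l) - phi x] pointwise gives
   [int psi^*(h + l) dnu <= Phi_star h] by monotone convergence. *)

Require Import Defs.
From HB Require Import structures.
From mathcomp Require Import all_boot all_order all_algebra.
From mathcomp Require Import all_classical all_reals all_analysis.
From mathcomp Require Import measurable_realfun.
From mathcomp Require Import ring lra.
Import Order.TTheory GRing.Theory Num.Theory.
Import numFieldNormedType.Exports.
Local Open Scope classical_set_scope.
Local Open Scope ring_scope.
Local Open Scope ereal_scope.

Set Implicit Arguments.
Unset Strict Implicit.
Unset Printing Implicit Defensive.

(** * One-dimensional convex duality *)

(** Two obstacles shape the proof. First, value functions may be infinite and infima unattained, so
    supporting lines are built for convex subsets of the plane, made of values realized by some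
    charge, and their slope is a supremum of chord slopes. The multiplier [l] exists because the
    domain of [phi] contains a neighborhood of 1: the charge [(1 + a) nu] has finite divergence
    [phi (1 + a)] for small [a] of either sign, so mass 1 is interior to the feasible masses.
    Second, decomposability supplies only bounded densities, while a pointwise maximizer may be
    unbounded or fail to exist. Finite maxima over rational points of the domain of [phi] are
    bounded and measurable by construction, and they still exhaust the conjugate. *)

Lemma lee_real_minorants (R : realType) (x y : \bar R) : 0 <= x ->
  (forall r : R, r%:E < x -> r%:E <= y) -> x <= y.
Proof.
case: x => [x| |]// _ H.
  apply/lee_addgt0Pr => e e0; rewrite -leeBlDr// -EFinB; apply: H.
  by rewrite lte_fin; lra.
rewrite (_ : y = +oo)//; apply: eq_infty => r; apply: H; exact: ltry.
Qed.

Section supporting_lines.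
Context (R : realType).
Implicit Types (S : set (R * R)) (f : R -> \bar R).

Definition convex_region S := forall (p q : R * R) (t : R), S p -> S q ->
  (0 <= t <= 1)%R ->
  S (t * p.1 + (1 - t) * q.1, t * p.2 + (1 - t) * q.2)%R.

(** The segment joining the two points meets the axis with weight [t = b / (b - a)] on the left
    point, at height at least [r]. Cleared of denominators: chord slopes from [(0, r)] to the left
    never exceed those to the right. *)
Lemma convex_region_cross {S} {r a v b w : R} : convex_region S ->
  (forall v, S (0%R, v) -> (r <= v)%R) -> S (a, v) -> S (b, w) ->
  (a < 0)%R -> (0 < b)%R -> (a * (w - r) <= b * (v - r))%R.
Proof.
move=> cS Sr Sv Sw a0 b0.
have ba : (0 < b - a)%R by lra.
pose t := (b / (b - a))%R.
have t01 : (0 <= t <= 1)%R.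
  by rewrite /t ler_pdivrMr// divr_ge0 ?(ltW b0) ?(ltW ba)//=; lra.
have tE : (t * (b - a) = b)%R by rewrite /t divfK// gt_eqF.
have := cS _ _ _ Sv Sw t01; rewrite /=.
rewrite (_ : (t * a + (1 - t) * b)%R = 0%R); last by lra.
move=> /Sr; rewrite -(ler_pM2r ba) => H.
have E : ((t * v + (1 - t) * w) * (b - a) = b * v - a * w)%R.
  rewrite mulrDl mulrAC tE (mulrAC _ w).
  by rewrite mulrBl mul1r tE; ring.
by move: H; rewrite E; lra.
Qed.

(** The slope is the supremum of the chord slopes from [(0, r)] to the left. The growth bound keeps
    these below [M] and the slopes to the right above [- M]; putting [- M] in the set keeps it
    nonempty when no point lies on the left. *)
Lemma supporting_line {S} {r M : R} : convex_region S ->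
  (forall a v, S (a, v) -> (r - M * `|a| <= v)%R) ->
  exists k : R, forall a v, S (a, v) -> (r + k * a <= v)%R.
Proof.
move=> cS SM.
have Sr v : S (0%R, v) -> (r <= v)%R by move/SM; rewrite normr0; lra.
pose A : set R := [set s | s = (- M)%R \/
  exists a v, [/\ S (a, v), (a < 0)%R & s = ((v - r) / a)%R]].
have A0 : A !=set0 by exists (- M)%R; left.
have ubA s a v : A s -> S (a, v) -> (0 < a)%R -> (s <= (v - r) / a)%R.
  move=> [->|[b [w [Sw b0 ->]]]] Sv a0.
    rewrite ler_pdivlMr//; have := SM _ _ Sv.
    by rewrite gtr0_norm//; lra.
  rewrite ler_ndivrMr// mulrAC ler_pdivrMr//.
  by have := convex_region_cross cS Sr Sw Sv b0 a0; lra.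
have hA : has_ubound A.
  exists (Num.max M (- M)%R) => s [->|[a [v [Sv a0 ->]]]].
    by rewrite le_max lexx orbT.
  rewrite le_max; apply/orP; left; rewrite ler_ndivrMr//.
  by have := SM _ _ Sv; rewrite ltr0_norm//; lra.
exists (sup A) => a v Sv; have [a0|a0|a0] := ltgtP a 0%R.
- have : ((v - r) / a <= sup A)%R.
    by apply: (ub_le_sup hA); right; exists a, v.
  by rewrite ler_ndivrMr//; lra.
- have : (sup A <= (v - r) / a)%R.
    by apply: (ge_sup A0) => s As; exact: ubA As Sv a0.
  by rewrite ler_pdivlMr//; lra.
- by move: Sv; rewrite a0 => /Sr; rewrite mulr0 addr0.
Qed.

(** One point on each side bounds all chord slopes on the opposite side, which gives the linear
    growth bound asked by [supporting_line]. *)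
Lemma supporting_line_interior {S} {r a0 v0 b0 w0 : R} : convex_region S ->
  (forall v, S (0%R, v) -> (r <= v)%R) ->
  S (a0, v0) -> (a0 < 0)%R -> S (b0, w0) -> (0 < b0)%R ->
  exists k : R, forall a v, S (a, v) -> (r + k * a <= v)%R.
Proof.
move=> cS Sr Sa a00 Sb b00.
pose c := ((w0 - r) / b0)%R; pose c' := ((v0 - r) / a0)%R.
have cE : (c * b0 = w0 - r)%R by rewrite /c divfK// gt_eqF.
have c'E : (c' * a0 = v0 - r)%R by rewrite /c' divfK// lt_eqF.
pose M := Num.max `|c|%R `|c'|%R.
have cM : (c <= M)%R by rewrite le_max (le_trans (ler_norm _)).
have c'M : (- M <= c')%R.
  by rewrite lerNl le_max; apply/orP; right; rewrite -normrN ler_norm.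
apply: (@supporting_line _ r M cS) => a v Sv; have [a_0|a_0|a_0] := ltgtP a 0%R.
- have := convex_region_cross cS Sr Sv Sb a_0 b00.
  rewrite -cE ltr0_norm// => H.
  have : (b0 * (a * c) <= b0 * (v - r))%R by lra.
  rewrite ler_pM2l//.
  have : (a * M <= a * c)%R by rewrite ler_nM2l.
  by lra.
- have := convex_region_cross cS Sr Sa Sv a00 a_0.
  rewrite -c'E gtr0_norm// => H.
  have : (a0 * (v - r) <= a0 * (a * c'))%R by lra.
  rewrite ler_nM2l//.
  have : (a * (- M) <= a * c')%R by rewrite ler_pM2l.
  by lra.
- by move: Sv; rewrite a_0 normr0 mulr0 subr0; exact: Sr.
Qed.

Lemma conjugate_ub f x y : (x * y)%:E - f x <= conjugate f y.
Proof. by apply: ereal_sup_ubound; exists x. Qed.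

Lemma biconjugate_le f x : 0 <= f x -> conjugate (conjugate f) x <= f x.
Proof.
case fx : (f x) => [r| |]// _; last by rewrite leey.
apply: ge_ereal_sup => _ [y _ <-].
have := conjugate_ub f x y; rewrite fx.
case: (conjugate f y) => [s| |]//=; last by rewrite leNye.
by rewrite -!EFinB !lee_fin; lra.
Qed.

(** The minorant of slope [k] gives [conjugate f k <= k * e - r], so the single slope [k] already
    contributes [r] to the biconjugate. *)
Lemma affine_minorant_biconjugate f (e r k : R) : (forall x, 0 <= f x) ->
  (forall x v, f x = v%:E -> (r + k * (x - e) <= v)%R) ->
  r%:E <= conjugate (conjugate f) e.
Proof.
move=> f0 H; apply: le_trans (conjugate_ub _ k e).
have : conjugate f k <= (k * e - r)%:E.
  apply: ge_ereal_sup => _ [x _ <-].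
  move: (f0 x); case fx : (f x) => [v| |]// _; last by rewrite leNye.
  by rewrite -EFinB lee_fin; have := H _ _ fx; lra.
case: (conjugate f k) => [s| |]//.
  by rewrite -!EFinB !lee_fin; lra.
by move=> _; rewrite leey.
Qed.

Definition epigraph_at f (e : R) : set (R * R) :=
  [set p | f (e + p.1)%R <= p.2%:E].

Lemma convex_region_epigraph_at {f} e : (forall x, 0 <= f x) -> econvex f ->
  convex_region (epigraph_at f e).
Proof.
move=> f0 cf [a v] [b w] t; rewrite /epigraph_at/= => fa fb /andP[t0 t1].
have -> : (e + (t * a + (1 - t) * b) = t * (e + a) + (1 - t) * (e + b))%R.
  by ring.
apply: le_trans (cf _ _ _ _) _; first by rewrite t0.
rewrite [leRHS]EFinD 2!EFinM; apply: leeD; apply: lee_pmul => //; rewrite lee_fin//.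
by rewrite subr_ge0.
Qed.

Lemma biconjugate_interior f e : (forall x, 0 <= f x) -> econvex f ->
  (edom f)° e -> f e = conjugate (conjugate f) e.
Proof.
move=> f0 cf ie; apply/eqP; rewrite eq_le biconjugate_le// andbT.
move: (ie) => [d /= d0 dP].
have dom x : (`|x| < d)%R -> exists v, f (e + x)%R = v%:E.
  move=> xd; have : edom f (e + x)%R.
    by apply: dP; rewrite /ball_/= opprD addNKr normrN.
  by rewrite /edom/=; move: (f0 (e + x)%R); case: (f _) => // v; exists v.
have h0 : (0 < d / 2)%R by rewrite divr_gt0.
have [r] := dom 0%R (ltac:(by rewrite normr0)); rewrite addr0 => fe; rewrite fe.
have [v0 va] := dom (- (d / 2))%R (ltac:(by rewrite normrN gtr0_norm//; lra)).
have [w0 wb] := dom (d / 2)%R (ltac:(by rewrite gtr0_norm//; lra)).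
have [k kP] : exists k : R, forall a v, epigraph_at f e (a, v) ->
    (r + k * a <= v)%R.
  apply: (@supporting_line_interior _ r (- (d / 2))%R v0 (d / 2)%R w0) => //.
  - exact: convex_region_epigraph_at.
  - by move=> v; rewrite /epigraph_at/= addr0 fe lee_fin.
  - by rewrite /epigraph_at/= va.
  - by lra.
  - by rewrite /epigraph_at/= wb.
apply: (@affine_minorant_biconjugate f e r k f0) => x v fx.
by apply: kP; rewrite /epigraph_at/= subrKC fx.
Qed.

Lemma conjugate_lsc f : lower_semicontinuous (conjugate f).
Proof.
move=> y a /ereal_sup_gt[_ [x _ <-] ax].
have H y' : a%:E < (x * y')%:E - f x -> a%:E < conjugate f y'.
  by move=> /lt_le_trans; apply; exact: conjugate_ub.
move: ax H; case: (f x) => [v| |] ax H//; last first.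
  by exists setT; [exact: filterT|move=> y' _; apply: H].
exists [set y' | a < x * y' - v]%R; last first.
  by move=> y' ay'; apply: H; rewrite -EFinB lte_fin.
move: ax; rewrite -EFinB lte_fin => ax.
apply: open_nbhs_nbhs; split => //.
apply: (@open_comp _ _ (fun y' => x * y' - v)%R [set z | a < z]%R).
  move=> z _; apply: cvgB; last exact: cvg_cst.
  by apply: cvgM; [exact: cvg_cst|exact: cvg_id].
exact: open_gt.
Qed.

Lemma biconjugate_lsc f : (forall x, 0 <= f x) -> econvex f ->
  lower_semicontinuous f <-> (forall e, f e = conjugate (conjugate f) e).
Proof.
move=> f0 cf; split => [lf e|H]; last first.
  by rewrite (funext H : f = _); exact: conjugate_lsc.
apply/eqP; rewrite eq_le biconjugate_le// andbT.
apply: lee_real_minorants => // r rf.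
have [V /= [d /= d0 dV] VP] := lf _ _ rf.
(* Within distance [d], lower semicontinuity gives [r < v]; farther away the choice of [M] makes
   [r - M * |a| <= 0], so nonnegativity of [f] suffices. *)
pose M := (`|r| / d)%R.
have M0 : (0 <= M)%R by rewrite divr_ge0// ltW.
have [k kP] : exists k : R, forall a v, epigraph_at f e (a, v) ->
    (r + k * a <= v)%R.
  apply: (@supporting_line _ r M); first exact: convex_region_epigraph_at.
  rewrite /epigraph_at/= => a v fv; have [ad|da] := ltP `|a|%R d.
    have : (r < v)%R.
      rewrite -lte_fin; apply: lt_le_trans fv; apply: VP; apply: dV.
      by rewrite /ball_/= opprD addNKr normrN.
    have := mulr_ge0 M0 (normr_ge0 a); lra.
  have v0 : (0 <= v)%R by rewrite -lee_fin (le_trans (f0 _) fv).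
  have : (`|r| <= M * `|a|)%R by rewrite /M mulrAC ler_pdivlMr// ler_wpM2l.
  by have := ler_norm r; lra.
apply: (@affine_minorant_biconjugate f e r k f0) => x v fx.
by apply: kP; rewrite /epigraph_at/= subrKC fx.
Qed.

End supporting_lines.

(** * Growth at infinity and conjugate of a divergence generator *)

Section divergence_generators.
Context (R : realType) (phi : R -> \bar R).
Hypothesis gphi : divergence_generator phi.

Lemma generator_chord (x y : R) : (1 < x)%R -> (x <= y)%R ->
  phi x <= ((x - 1) / (y - 1))%:E * phi y.
Proof.
move=> x1 xy; have y1 : (0 < y - 1)%R by lra.
set t := ((x - 1) / (y - 1))%R.
have t01 : (0 <= t <= 1)%R.
  by rewrite /t divr_ge0//= ?ler_pdivrMr//; lra.
have := dg_convex gphi y 1%R t01.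
rewrite (dg1 gphi) mule0 adde0.
suff -> : (t * y + (1 - t) * 1 = x)%R by [].
by have : (t * (y - 1) = x - 1)%R; [rewrite /t divfK// gt_eqF|lra].
Qed.

(** Since [(x - 1) / (y - 1) <= x / y], the chord inequality based at 1 passes to slopes based at 0,
    the ones in [slope_pinfty]. *)
Lemma generator_slope_nondecreasing (x y : R) : (1 <= x)%R -> (x <= y)%R ->
  phi x * (x^-1)%:E <= phi y * (y^-1)%:E.
Proof.
rewrite le_eqVlt => /orP[/eqP <- y1|x1 xy].
  rewrite (dg1 gphi) mul0e mule_ge0//; first exact: dg_ge0 gphi _.
  by rewrite lee_fin invr_ge0; lra.
have x0 : (0 < x)%R by lra.
have y0 : (0 < y)%R by lra.
have y1 : (0 < y - 1)%R by lra.
have c0 : ((x - 1) / (y - 1) <= x / y)%R.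
  by rewrite ler_pdivrMr// mulrAC ler_pdivlMr//; lra.
have -> : phi y * (y^-1)%:E = (x / y)%:E * phi y * (x^-1)%:E.
  by rewrite muleAC -EFinM mulrAC mulfV ?gt_eqF// mul1r muleC.
apply: lee_wpmul2r; first by rewrite lee_fin invr_ge0 ltW.
rewrite /=; apply: le_trans (generator_chord x1 xy) _.
by apply: lee_wpmul2r; [exact: dg_ge0 gphi _|rewrite lee_fin].
Qed.

Lemma generator_le_slope_pinfty (x : R) : (1 <= x)%R ->
  phi x * (x^-1)%:E <= slope_pinfty phi.
Proof.
(* Freezing the quotient below 1 makes it monotone on all of [R], so its limit exists and is its
   supremum. *)
move=> x1; pose f y := phi (Num.max 1 y)%R * ((Num.max 1 y)^-1)%:E.
have ndf : {homo f : y z / (y <= z)%R >-> y <= z}.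
  move=> y z yz; apply: generator_slope_nondecreasing.
    by rewrite le_max lexx.
  by rewrite ge_max !le_max lexx yz orbT.
have cf := nondecreasing_cvge ndf.
have -> : slope_pinfty phi = ereal_sup (range f).
  apply: cvg_lim => //; apply: cvg_trans cf; apply: near_eq_cvg.
  near=> y; rewrite /f max_r//; near: y; exact: nbhs_pinfty_ge.
have -> : phi x * (x^-1)%:E = f x by rewrite /f max_r.
by apply: ereal_sup_ubound; exists x.
Unshelve. all: by end_near. Qed.

Lemma slope_pinfty_ge0 : 0 <= slope_pinfty phi.
Proof.
apply: le_trans (generator_le_slope_pinfty (lexx 1%R)).
by rewrite (dg1 gphi) mul0e.
Qed.

Lemma generator_le_linear (s : R) : (0 <= s)%R ->
  phi (1 + s)%R <= s%:E * slope_pinfty phi.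
Proof.
rewrite le_eqVlt => /orP[/eqP <-|s0].
  by rewrite addr0 (dg1 gphi) mul0e.
case cE : (slope_pinfty phi) slope_pinfty_ge0 => [c| |]// c0; last first.
  by rewrite gt0_muley ?lte_fin// leey.
rewrite lee_fin in c0; rewrite -EFinM.
apply/lee_addgt0Pr => e e0.
(* The chord to [y] and [phi y <= c * y] give the bound [s * c + s * c / (y - 1)]; this [y] makes
   the error at most [e]. *)
pose y := (1 + s + s * c / e)%R.
have H0 : (0 <= s * c / e)%R by rewrite divr_ge0 ?mulr_ge0// ltW.
have sy : (1 + s <= y)%R by rewrite /y; lra.
have y0 : (0 < y)%R by lra.
have y1 : (0 < y - 1)%R by lra.
have s1 : (1 < 1 + s)%R by lra.
apply: le_trans (generator_chord s1 sy) _.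
have py : phi y <= (c * y)%:E.
  have := @generator_le_slope_pinfty y (ltac:(lra)); rewrite cE.
  by rewrite lee_pdivrMr// EFinM.
apply: (@le_trans _ _ (((1 + s - 1) / (y - 1))%:E * (c * y)%:E)).
  by apply: lee_wpmul2l => //; rewrite lee_fin divr_ge0//; lra.
rewrite -EFinM -EFinD lee_fin mulrAC ler_pdivrMr//.
have E : (s * c / e * e = s * c)%R by rewrite divfK// gt_eqF.
have -> : ((s * c + e) * (y - 1) = s * c * y + e * s + (s * c / e * e - s * c))%R.
  by rewrite /y; ring.
rewrite E subrr addr0 addrAC subrr add0r mulrA lerDl.
by rewrite mulr_ge0// ltW.
Qed.

Local Notation psi_star := (conjugate (recenter phi)).

Lemma conjugate_recenter_ge (x y : R) : ((x - 1) * y)%:E <= psi_star y + phi x.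
Proof.
have := conjugate_ub (recenter phi) (x - 1) y; rewrite /recenter subrK.
have := dg_ge0 gphi x; case: (phi x) => [v| |]// _; last first.
  move=> _; rewrite addey ?leey// -ltNye.
  apply: lt_le_trans (conjugate_ub _ 0%R y).
  by rewrite /recenter add0r (dg1 gphi) sube0 ltNyr.
by rewrite leeBlDr.
Qed.

Lemma conjugate_recenter_ge0 (y : R) : 0 <= psi_star y.
Proof.
by have := conjugate_recenter_ge 1 y; rewrite subrr mul0r (dg1 gphi) adde0.
Qed.

(* On the segment from [x] to [1] convexity bounds [phi] by its chord, which
   is continuous at [x]; so rational abscissae suffice. *)
Lemma conjugate_recenter_rat (y r : R) : r%:E < psi_star y ->
  exists2 q : rat, phi (ratr q) < +oo &
    (r < (ratr q - 1) * y - fine (phi (ratr q)))%R.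
Proof.
move=> /ereal_sup_gt[_ [x0 _ <-]]; rewrite /recenter.
have -> : x0 = (x0 + 1 - 1)%R by rewrite addrK.
move: (x0 + 1)%R => {}x0; rewrite subrK.
have := dg_ge0 gphi x0; case fx : (phi x0) => [v| |]// v0 rv.
rewrite lee_fin in v0; rewrite -EFinB lte_fin in rv.
have [x01|x01] := eqVneq x0 1%R.
  exists 1%R; rewrite rmorph1 (dg1 gphi)// subrr.
  by move: rv v0; rewrite x01 subrr/=; lra.
(* At [(1 - t) * x0 + t] the chord bound loses at most [t * ((x0 - 1) * y - v)], hence less than
   [t * B]; taking [t < gap / B] keeps the value above [r]. *)
pose gap := ((x0 - 1) * y - v - r)%R.
have gap0 : (0 < gap)%R by rewrite /gap; lra.
pose B := (`|(x0 - 1) * y - v| + 1)%R.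
have B0 : (0 < B)%R by rewrite ltr_wpDl.
pose u := Num.min 1%R (gap / B)%R.
have u0 : (0 < u)%R by rewrite lt_min ltr01 divr_gt0.
have [q [t [t0 tu qE]]] : exists q : rat, exists t : R,
    [/\ (0 < t)%R, (t < u)%R & ratr q = ((1 - t) * x0 + t * 1)%R].
  pose z := (x0 + u * (1 - x0))%R.
  have x10 : (1 - x0 != 0)%R by rewrite subr_eq0 eq_sym.
  have zP q : (Num.min x0 z < ratr q < Num.max x0 z)%R -> exists t : R,
      [/\ (0 < t)%R, (t < u)%R & ratr q = ((1 - t) * x0 + t * 1)%R].
    move=> /andP[q1 q2]; exists ((ratr q - x0) / (1 - x0))%R.
    have E : ((ratr q - x0) / (1 - x0) * (1 - x0) = ratr q - x0)%R.
      by rewrite divfK.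
    have [x1|x1] := ltP x0 1%R.
      have x1' : (0 < 1 - x0)%R by lra.
      have uz : (0 < u * (1 - x0))%R by rewrite mulr_gt0.
      have xz : (x0 < z)%R by rewrite /z; lra.
      rewrite min_l ?(ltW xz)// in q1; rewrite max_r ?(ltW xz)// in q2.
      split; [by rewrite divr_gt0//; lra| |by lra].
      by rewrite ltr_pdivrMr//; move: q2; rewrite /z; lra.
    have x1' : (1 - x0 < 0)%R by move: x10; rewrite neq_lt => /orP[//|]; lra.
    have uz : (u * (1 - x0) < 0)%R by rewrite pmulr_rlt0.
    have xz : (z < x0)%R by rewrite /z; lra.
    rewrite min_r ?(ltW xz)// in q1; rewrite max_l ?(ltW xz)// in q2.
    split; [|by rewrite ltr_ndivrMr//; move: q1; rewrite /z; lra|by lra].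
    by rewrite ltr_ndivlMr// mul0r; lra.
  have [q qP] : exists q, (Num.min x0 z < ratr q < Num.max x0 z)%R.
    have mM : (Num.min x0 z < Num.max x0 z)%R.
      have : (x0 != z)%R.
        by rewrite -subr_eq0 /z opprD addNKr oppr_eq0 mulf_neq0// gt_eqF.
      by rewrite neq_lt lt_max !gt_min !ltxx/= => /orP[] ->; rewrite ?orbT.
    by have [q] := rat_in_itvoo mM; rewrite in_itv/= => qP; exists q.
  by exists q; exact: zP qP.
have t1 : (t < 1)%R by apply: lt_le_trans tu _; rewrite ge_min lexx.
have := dg_convex gphi x0 1%R (t := (1 - t)%R).
rewrite subKr -qE fx (dg1 gphi) mule0 adde0 -EFinM => qv.
have {}qv := qv (ltac:(lra)).
have qfin : phi (ratr q) \is a fin_num.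
  by rewrite ge0_fin_numE ?(le_lt_trans qv) ?ltry//; exact: dg_ge0 gphi _.
exists q; first by rewrite -ge0_fin_numE//; exact: dg_ge0 gphi _.
move: qv; rewrite -(fineK qfin) lee_fin /=.
move: (fine _) => w qv; rewrite {}qE.
have : (t * B < gap)%R.
  rewrite -ltr_pdivlMr//; apply: lt_le_trans tu _.
  by rewrite ge_min lexx orbT.
have : (((x0 - 1) * y - v) * t <= B * t)%R.
  by rewrite ler_pM2r// /B; have := ler_norm ((x0 - 1) * y - v)%R; lra.
rewrite /gap; lra.
Qed.

End divergence_generators.

(** * Lebesgue decomposition of nonnegative charges *)

Section nonneg_charges.
Local Open Scope charge_scope.
Context d (T : measurableType d) (R : realType).
Implicit Types (mu : {charge set T -> \bar R}) (m : {measure set T -> \bar R})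
  (nu : {finite_measure set T -> \bar R}) (N : set T) (h p : T -> R).

Lemma charge_neg0 mu A : nonneg_charge mu -> measurable A ->
  charge_neg mu A = 0.
Proof.
move=> mu0 mA; rewrite [LHS](jordan_negE (hahnP mu)) cjordan_negE /crestr0 mem_set//.
have [_ [mN N0] _ _] := hahnP mu; apply/eqP; rewrite eqe_oppLR oppe0.
rewrite eq_le mu0 ?andbT; last exact: measurableI.
by apply: N0; [exact: measurableI|exact: subIsetr].
Qed.

Lemma charge_posE mu A : nonneg_charge mu -> measurable A ->
  charge_pos mu A = mu A.
Proof.
move=> mu0 mA; rewrite [RHS](jordan_decomp (hahnP mu) mA)/= /cadd/=.
rewrite [X in _ = _ + X](_ : _ = 0) ?adde0//.
by rewrite cscaleN1/= (charge_neg0 mu0 mA) oppe0.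
Qed.

Lemma charge_integralE mu m h : nonneg_charge mu ->
  (forall A, measurable A -> m A = mu A) ->
  charge_integral mu h = fine (\int[m]_x (h x)%:E).
Proof.
move=> mu0 mE; rewrite /charge_integral /Rintegral.
rewrite (@eq_measure_integral _ _ _ _ m) => [|A mA _]; last first.
  by rewrite mE//; exact: charge_posE.
rewrite (@eq_measure_integral _ _ _ _ mzero (charge_neg mu)) => [|A mA _].
  by rewrite integral_measure_zero subr0.
exact: charge_neg0.
Qed.

Lemma integrable_charge_pos mu m (f : T -> \bar R) : nonneg_charge mu ->
  (forall A, measurable A -> m A = mu A) ->
  (Defs.total_variation mu).-integrable setT f -> m.-integrable setT f.
Proof.
move=> mu0 mE /integrableP[mf fi]; apply/integrableP; split => //.
rewrite (@eq_measure_integral _ _ _ _ (Defs.total_variation mu)) => // A mA _.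
rewrite mE//; transitivity (charge_pos mu A + charge_neg mu A) => //.
by rewrite charge_posE// charge_neg0// adde0.
Qed.

Lemma ge0_integral_lincomb m m1 m2 (a b : R) (f : T -> \bar R) :
  (0 <= a)%R -> (0 <= b)%R ->
  (forall A, measurable A -> m A = a%:E * m1 A + b%:E * m2 A) ->
  measurable_fun setT f -> (forall x, 0 <= f x) ->
  \int[m]_x f x = a%:E * \int[m1]_x f x + b%:E * \int[m2]_x f x.
Proof.
move=> a0 b0 mE mf f0.
rewrite (@eq_measure_integral _ _ _ _
  (measure_add (mscale (NngNum a0) m1) (mscale (NngNum b0) m2))).
  by rewrite ge0_integral_measure_add// !ge0_integral_mscale.
move=> A mA _; rewrite mE//; symmetry.
exact: (measure_addE (mscale (NngNum a0) m1) (mscale (NngNum b0) m2)).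
Qed.

Lemma nonneg_charge_lincomb mu1 mu2 (a b : R) : nonneg_charge mu1 ->
  nonneg_charge mu2 -> (0 <= a)%R -> (0 <= b)%R ->
  nonneg_charge (cadd (cscale a mu1) (cscale b mu2)).
Proof.
move=> mu10 mu20 a0 b0 A mA; rewrite /cadd/= /cscale.
by apply: adde_ge0; apply: mule_ge0; rewrite ?lee_fin//; [exact: mu10|exact: mu20].
Qed.

(** Jordan parts are not additive in general. For nonnegative charges and coefficients the positive
    part is the charge itself, and the claim reduces to integrals against measures. *)
Lemma charge_integral_lincomb mu1 mu2 (a b : R) h : nonneg_charge mu1 ->
  nonneg_charge mu2 -> (0 <= a)%R -> (0 <= b)%R ->
  (Defs.total_variation mu1).-integrable setT (EFin \o h) ->
  (Defs.total_variation mu2).-integrable setT (EFin \o h) ->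
  charge_integral (cadd (cscale a mu1) (cscale b mu2)) h =
  (a * charge_integral mu1 h + b * charge_integral mu2 h)%R.
Proof.
move=> mu10 mu20 a0 b0 i1 i2.
have mu0 := nonneg_charge_lincomb mu10 mu20 a0 b0.
move: mu0; set mu : {charge set T -> \bar R} := cadd _ _ => mu0.
have pE mu3 : nonneg_charge mu3 ->
  forall A, measurable A -> charge_pos mu3 A = mu3 A.
  by move=> mu30 A mA; rewrite charge_posE.
rewrite (charge_integralE h mu0 (pE _ mu0)).
rewrite (charge_integralE h mu10 (pE _ mu10)).
rewrite (charge_integralE h mu20 (pE _ mu20)).
have := integrable_charge_pos mu10 (pE _ mu10) i1.
have := integrable_charge_pos mu20 (pE _ mu20) i2.
set m := charge_pos mu; set m1 := charge_pos mu1; set m2 := charge_pos mu2.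
move=> j2 j1.
have mE A : measurable A -> m A = a%:E * m1 A + b%:E * m2 A.
  by move=> mA; rewrite /m /m1 /m2 !charge_posE.
have mh : measurable_fun setT (EFin \o h) by exact: measurable_int j1.
have := integrable_pos_fin_num measurableT j1; have := integrable_neg_fin_num measurableT j1.
have := integrable_pos_fin_num measurableT j2; have := integrable_neg_fin_num measurableT j2.
rewrite !(integralE _ _ (EFin \o h)).
rewrite (ge0_integral_lincomb a0 b0 mE (measurable_funepos mh))//.
rewrite (ge0_integral_lincomb a0 b0 mE (measurable_funeneg mh))//.
move=> /fineK <- /fineK <- /fineK <- /fineK <-.
by rewrite /=; ring.
Qed.

(** A Lebesgue decomposition with explicit data: a density finite and nonnegative at every point,
    and a [nu]-null carrier [N] of the singular part. By contrast [ac_part] and [sing_part] come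
    from a choice, and the derivative of [ac_part] is controlled only almost everywhere. *)
Definition density_split nu (mu : set T -> \bar R) p N :=
  [/\ measurable N, nu N = 0, nu.-integrable setT (EFin \o p),
      forall x, (0 <= p x)%R
    & forall A, measurable A ->
        mu A = \int[nu]_(x in A) (p x)%:E + mu (A `&` N)].

(** Off the carrier of the singular part, [mu] is a measure dominated by [nu], and the Radon-Nikodym
    derivative of a measure is available in a version finite and nonnegative everywhere. *)
Lemma density_split_ex nu mu : nonneg_charge mu ->
  exists p N, density_split nu mu p N.
Proof.
move=> mu0; have [muE muc [N [mN N0 msN]]] := ac_sing_partP mu nu.
have mNC : measurable (~` N) by exact: measurableC.
have oo : charge_pos mu (~` N) < +oo.
  by rewrite -ge0_fin_numE// fin_num_measure.
pose m := mfrestr mNC oo.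
have mE A : measurable A -> m A = mu (A `\` N).
  move=> mA; rewrite setDE/= /m /mfrestr /mrestr charge_posE//.
  exact: measurableI.
have mnu : m `<< nu.
  apply/null_content_dominatesP => A mA A0; rewrite mE// muE; last first.
    exact: measurableD.
  have mAN : measurable (A `\` N) by exact: measurableD.
    rewrite /= /cadd/= [X in X + _](_ : _ = 0) ?add0e.
    apply/eqP; rewrite -abse_eq0 eq_le abse_ge0 andbT -msN.
    apply: le_trans (abse_le_total_variation _ mAN) _.
    by apply: le_measure; rewrite ?inE//; exact: subDsetr.
  move/null_content_dominatesP : muc; apply => //.
  by apply: (subset_measure0 mAN mA) => //; exact: subDsetl.
pose f := Radon_Nikodym_SigmaFinite.f m nu.
have ffin := Radon_Nikodym_SigmaFinite.f_fin_num mnu.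
exists (fine \o f), N; split => //.
- by apply: eq_integrable (Radon_Nikodym_SigmaFinite.f_integrable mnu) => //
    x _; rewrite /= fineK.
- by move=> x; rewrite /= fine_ge0// Radon_Nikodym_SigmaFinite.f_ge0.
- move=> A mA.
  under eq_integral do rewrite /= fineK//.
  have -> : \int[nu]_(x in A) f x = m A.
    by rewrite /f -Radon_Nikodym_SigmaFinite.f_integral.
  by rewrite mE//; exact: chargeDI.
Qed.

Section density_split_theory.
Variables (nu : {finite_measure set T -> \bar R}).
Variables (mu : {charge set T -> \bar R}) (p : T -> R) (N : set T).
Hypotheses (mu0 : nonneg_charge mu) (sp : density_split nu mu p N).

Let mN : measurable N. Proof. by have [] := sp. Qed.
Let N0 : nu N = 0. Proof. by have [] := sp. Qed.
Let ip : nu.-integrable setT (EFin \o p). Proof. by have [] := sp. Qed.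
Let p0 x : (0 <= p x)%R. Proof. by have [] := sp. Qed.
Let mp : measurable_fun setT (EFin \o p). Proof. exact: measurable_int ip. Qed.
Let muE A : measurable A -> mu A = \int[nu]_(x in A) (p x)%:E + mu (A `&` N).
Proof. by have [_ _ _ _] := sp; exact. Qed.

Lemma density_splitD M A : measurable M -> measurable A -> nu M = 0 ->
  N `<=` M -> mu (A `\` M) = \int[nu]_(x in A) (p x)%:E.
Proof.
move=> mM mA M0 NM; rewrite muE; last exact: measurableD.
rewrite (_ : (A `\` M) `&` N = set0); last first.
  by apply/seteqP; split => // x [[_ Mx] /NM].
rewrite charge0 adde0 -negligible_integral//.
exact: integrableS ip.
Qed.

Lemma density_split_null M : measurable M -> nu M = 0 -> mu M = mu (M `&` N).
Proof.
move=> mM M0; rewrite muE// null_set_integral ?add0e//.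
exact: measurable_funTS.
Qed.

(** Uniqueness of the Lebesgue decomposition: off the union of the two carriers both singular parts
    vanish, and this union, being [nu]-null, is invisible to both absolutely continuous parts. *)
Lemma ac_part_density_split A : measurable A ->
  ac_part mu nu A = \int[nu]_(x in A) (p x)%:E.
Proof.
move=> mA; have [mcs muc [N' [mN' N'0 msN]]] := ac_sing_partP mu nu.
pose M := N `|` N'.
have mM : measurable M by exact: measurableU.
have M0 : nu M = 0 by apply/eqP; rewrite measureU0//; apply/eqP.
have mAM : measurable (A `\` M) by exact: measurableD.
rewrite -(density_splitD mM mA M0); last exact: subsetUl.
rewrite mcs//= /cadd/= [X in _ = _ + X](_ : _ = 0) ?adde0; last first.
  apply/eqP; rewrite -abse_eq0 eq_le abse_ge0 andbT -msN.
  apply: le_trans (abse_le_total_variation _ mAM) _.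
  apply: le_measure; rewrite ?inE//; first exact: measurableC.
  by move=> x [_ Mx] N'x; apply: Mx; right.
rewrite (chargeDI _ mA mM) [X in _ + X](_ : _ = 0) ?adde0//.
move/null_content_dominatesP : muc; apply; first exact: measurableI.
by apply: (subset_measure0 _ mM) => //; exact: measurableI.
Qed.

Lemma sing_part_density_split A : measurable A ->
  sing_part mu nu A = mu (A `&` N).
Proof.
move=> mA; have [mcs _ _] := ac_sing_partP mu nu.
have Ff : \int[nu]_(x in A) (p x)%:E \is a fin_num.
  by apply: integrable_fin_num => //; exact: integrableS ip.
have := mcs _ mA; rewrite /= /cadd/= ac_part_density_split// muE// => E.
rewrite -[LHS](addeK _ Ff) -[RHS](addeK _ Ff).
by rewrite ![_ + \int[nu]_(x in A) _]addeC E.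
Qed.

Variable phi : R -> \bar R.
Hypothesis gphi : divergence_generator phi.

Let mphi : measurable_fun setT phi.
Proof. exact: lower_semicontinuous_measurable (dg_lsc gphi). Qed.

(** Any split computes the divergence. The [slope_ninfty] term drops because the singular part
    inherits nonnegativity, which makes its coefficient 0. *)
Lemma divergence_density_split : divergence phi mu nu =
  \int[nu]_x phi (p x) + mu N * slope_pinfty phi.
Proof.
have s0 : nonneg_charge (sing_part mu nu).
  by move=> A mA; rewrite sing_part_density_split// mu0//; exact: measurableI.
rewrite /divergence charge_neg0// mul0e sube0 charge_posE//.
rewrite sing_part_density_split// setTI; congr (_ + _).
have [_ muc _] := ac_sing_partP mu nu.
have RNfin x := Radon_Nikodym_fin_num x muc.
have mRN : measurable_fun setT ('d (ac_part mu nu) '/d nu).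
  exact: measurable_int (Radon_Nikodym_integrable muc).
have : ae_eq nu setT ('d (ac_part mu nu) '/d nu) (EFin \o p).
  apply: integral_ae_eq => //; first exact: Radon_Nikodym_integrable.
  move=> E _ mE; rewrite -Radon_Nikodym_integral//.
  exact: ac_part_density_split.
move=> RNp; apply: ge0_ae_eq_integral => //.
- apply: measurableT_comp => //; exact: measurableT_comp.
- by apply: measurableT_comp => //; exact/measurable_EFinP.
- by move=> x _; exact: dg_ge0 gphi _.
- by move=> x _; exact: dg_ge0 gphi _.
- by apply: filterS RNp => x /= /(_ I) -> _.
Qed.

(* The part of [mu] outside the [nu]-null set [N] has density [p]. *)
Lemma density_split_change_of_variables m (h : T -> R) :
  (forall A, measurable A -> m A = mu A) -> m.-integrable setT (EFin \o h) ->
  nu.-integrable setT (fun x => (h x * p x)%:E) /\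
  \int[m]_x (h x)%:E = \int[nu]_x (h x * p x)%:E + \int[m]_(x in N) (h x)%:E.
Proof.
move=> mE ih.
have mNC : measurable (~` N) by exact: measurableC.
have oo : m (~` N) < +oo by rewrite mE// ltey_eq fin_num_measure.
pose m' := mfrestr mNC oo.
have m'E A : measurable A -> m' A = \int[nu]_(x in A) (p x)%:E.
  move=> mA; transitivity (m (A `\` N)); first by rewrite setDE.
  by rewrite mE ?density_splitD//; exact: measurableD.
have m'nu : m' `<< nu.
  apply/null_content_dominatesP => A mA A0.
  by rewrite m'E// null_set_integral//; exact: measurable_funTS.
pose mc : {charge set T -> \bar R} := charge_of_finite_measure m'.
have mcnu : mc `<< nu by exact: m'nu.
have iq := Radon_Nikodym_integrable mcnu.
have mq : measurable_fun setT ('d mc '/d nu) by exact: measurable_int iq.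
have qp : ae_eq nu setT ('d mc '/d nu) (EFin \o p).
  apply: integral_ae_eq => // E _ mE'; rewrite -Radon_Nikodym_integral//.
  exact: m'E.
have mh : measurable_fun setT h by exact/measurable_EFinP/(measurable_int _ ih).
have mp' : measurable_fun setT p by exact/measurable_EFinP.
have m'm (f : T -> \bar R) : measurable_fun setT f ->
    \int[m']_(x in ~` N) f x = \int[m]_(x in ~` N) f x.
  move=> mf; apply: eq_measure_integral => A mA AN.
  transitivity (m (A `&` ~` N)) => //; congr (m _).
  by apply/setIidPl.
(* Stated for a general [k] because it serves twice: for [|h|], to get integrability of [h * p]
   under [nu], and then for [h] itself. *)
have cov (k : T -> R) : measurable_fun setT k ->
    m.-integrable setT (EFin \o k) ->
    \int[nu]_(x in ~` N) (k x * p x)%:E = \int[m]_(x in ~` N) (k x)%:E.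
  move=> mk ik; rewrite -m'm; last exact/measurable_EFinP.
  rewrite -(Radon_Nikodym_change_of_variables m'nu) => //.
    apply: ae_eq_integral => //.
    - by apply/measurable_funTS/measurable_EFinP/measurable_funM.
    - apply: emeasurable_funM; apply: measurable_funTS => //.
      exact/measurable_EFinP.
    - by apply: filterS qp => x /= /(_ I) -> _; rewrite EFinM.
  have := integrableS measurableT mNC (@subsetT _ _) ik.
  by move=> /integrableP[? ?]; apply/integrableP; split => //; rewrite m'm//;
    apply: measurableT_comp => //; exact/measurable_EFinP.
have mhp : measurable_fun setT (fun x => (h x * p x)%:E).
  by apply/measurable_EFinP/measurable_funM.
have ihp : nu.-integrable setT (fun x => (h x * p x)%:E).
  apply/(negligible_integrable mN measurableT mhp N0); rewrite setTD.
  apply/integrableP; split; first exact: measurable_funTS.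
  have := cov (Num.norm \o h) (measurableT_comp (@normr_measurable _ setT) mh)
    (integrable_norm ih).
  have E x : `|(h x * p x)%:E| = ((Num.norm \o h) x * p x)%:E.
    by rewrite abse_EFin normrM (ger0_norm (p0 x)).
  under [X in _ -> X < _]eq_integral do rewrite E.
  move=> ->; have := integrableS measurableT mNC (@subsetT _ _) ih.
  by move=> /integrableP[].
split => //.
rewrite -(setUv N) integral_setU//; last 2 first.
- by rewrite setUv; exact: measurable_int ih.
- by apply/disj_set2P; rewrite setICr.
rewrite addeC -(cov h)//.
by rewrite setUv (negligible_integral mN measurableT ihp N0) setTD.
Qed.

End density_split_theory.

End nonneg_charges.

(** * Divergence of nonnegative combinations of charges *)

Section divergence_combinations.
Context d (T : measurableType d) (R : realType).
Implicit Types (mu : {charge set T -> \bar R}) (p : T -> R) (N : set T).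
Variable nu : {finite_measure set T -> \bar R}.

(** The carrier may be enlarged to any [nu]-null set containing it, so two charges can be split
    along a common one. *)
Lemma density_split_measureI mu p N M A :
  density_split nu mu p N -> measurable A -> measurable M -> nu M = 0 ->
  N `<=` M -> mu (A `&` M) = mu (A `&` N).
Proof.
move=> sp mA mM M0 NM.
have mAM : measurable (A `&` M) by exact: measurableI.
rewrite (density_split_null sp mAM) -?setIA ?(setIidr NM)//.
by apply: (subset_measure0 mAM mM) => //; exact: subIsetr.
Qed.

Lemma density_split_lincomb mu1 mu2 p1 p2 N1 N2 (a b : R) :
  nonneg_charge mu1 -> nonneg_charge mu2 -> (0 <= a)%R -> (0 <= b)%R ->
  density_split nu mu1 p1 N1 -> density_split nu mu2 p2 N2 ->
  density_split nu (cadd (cscale a mu1) (cscale b mu2))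
    (fun x => a * p1 x + b * p2 x)%R (N1 `|` N2).
Proof.
move=> mu10 mu20 a0 b0 sp1 sp2.
have [mN1 N10 ip1 p10 mu1E] := sp1; have [mN2 N20 ip2 p20 mu2E] := sp2.
have mN : measurable (N1 `|` N2) by exact: measurableU.
have N0 : nu (N1 `|` N2) = 0 by apply/eqP; rewrite measureU0//; apply/eqP.
have i1 : nu.-integrable setT (fun x => a%:E * (p1 x)%:E).
  exact: integrableZl.
have i2 : nu.-integrable setT (fun x => b%:E * (p2 x)%:E).
  exact: integrableZl.
split => //.
- by have := integrableD measurableT i1 i2.
- by move=> x; rewrite addr_ge0// mulr_ge0.
- move=> A mA; rewrite /cadd/= /cscale.
  rewrite (density_split_measureI sp1 mA mN N0); last exact: subsetUl.
  rewrite (density_split_measureI sp2 mA mN N0); last exact: subsetUr.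
  under eq_integral do rewrite EFinD !EFinM.
  rewrite integralD//; [|exact: integrableS i1|exact: integrableS i2].
  rewrite !integralZl//; [|exact: integrableS ip2|exact: integrableS ip1].
  rewrite [in LHS]mu1E// [in LHS]mu2E//.
  move: (\int[nu]_(x in A) (p1 x)%:E) (\int[nu]_(x in A) (p2 x)%:E) => J1 J2.
  have f1 : mu1 (A `&` N1) \is a fin_num.
    by apply: fin_num_measure; exact: measurableI.
  have f2 : mu2 (A `&` N2) \is a fin_num.
    by apply: fin_num_measure; exact: measurableI.
  rewrite muleDr//; last exact: fin_num_adde_defl.
  rewrite [b%:E * _]muleDr//; last exact: fin_num_adde_defl.
  by rewrite addeACA.
Qed.

Variable phi : R -> \bar R.
Hypothesis gphi : divergence_generator phi.

Let mphi : measurable_fun setT phi.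
Proof. exact: lower_semicontinuous_measurable (dg_lsc gphi). Qed.

Let s0 := slope_pinfty_ge0 gphi.

Lemma measurable_generator_comp p :
  measurable_fun setT p -> measurable_fun setT (phi \o p).
Proof. exact: measurableT_comp. Qed.

Lemma divergence_ge0 mu : nonneg_charge mu -> 0 <= divergence phi mu nu.
Proof.
move=> mu0; have [p [N sp]] := density_split_ex nu mu0.
have [mN _ _ _ _] := sp.
rewrite (divergence_density_split mu0 sp gphi) adde_ge0 ?mule_ge0 ?mu0//.
by apply: integral_ge0 => x _; exact: dg_ge0 gphi _.
Qed.

(** Along a common carrier the divergence is the integral of [phi] at the density, convex pointwise,
    plus a term linear in the charge. *)
Lemma divergence_convex mu1 mu2 (t : R) : nonneg_charge mu1 ->
  nonneg_charge mu2 -> (0 <= t <= 1)%R ->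
  divergence phi (cadd (cscale t mu1) (cscale (1 - t) mu2)) nu <=
  t%:E * divergence phi mu1 nu + (1 - t)%:E * divergence phi mu2 nu.
Proof.
move=> mu10 mu20 t01; have /andP[t0] := t01; rewrite -subr_ge0 => t1.
have [p1 [N1 sp1]] := density_split_ex nu mu10.
have [p2 [N2 sp2]] := density_split_ex nu mu20.
have sp := density_split_lincomb mu10 mu20 t0 t1 sp1 sp2.
have mu0 := nonneg_charge_lincomb mu10 mu20 t0 t1.
have [mN N0 _ _ _] := sp.
have [mN1 _ /(measurable_int _)/measurable_EFinP mp1 _ _] := sp1.
have [mN2 _ /(measurable_int _)/measurable_EFinP mp2 _ _] := sp2.
have phi0 := dg_ge0 gphi.
have I0 (p : T -> R) : 0 <= \int[nu]_x phi (p x) by exact: integral_ge0.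
rewrite (divergence_density_split mu0 sp gphi).
rewrite (divergence_density_split mu10 sp1 gphi).
rewrite (divergence_density_split mu20 sp2 gphi).
have comb (x y u v : \bar R) : 0 <= x -> 0 <= y -> 0 <= u -> 0 <= v ->
    t%:E * (x + u) + (1 - t)%:E * (y + v) =
    (t%:E * x + (1 - t)%:E * y) + (t%:E * u + (1 - t)%:E * v).
  by move=> *; rewrite !ge0_muleDr// addeACA.
rewrite comb ?mule_ge0 ?mu10 ?mu20//; apply: leeD.
  rewrite -!ge0_integralZl//; try exact: measurable_generator_comp.
  rewrite -ge0_integralD//; last 4 first.
  - by move=> x _; rewrite mule_ge0.
  - exact/measurable_funeM/measurable_generator_comp.
  - by move=> x _; rewrite mule_ge0.
  - exact/measurable_funeM/measurable_generator_comp.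
  apply: ge0_le_integral => //.
  - apply: measurable_generator_comp.
    by apply: measurable_funD; exact: measurable_funM.
  - by apply: emeasurable_funD;
      exact/measurable_funeM/measurable_generator_comp.
  - by move=> x _; apply: (dg_convex gphi).
rewrite /= /cadd/= /cscale -(setTI (N1 `|` N2)).
rewrite (density_split_measureI sp1 _ mN N0)//.
rewrite (density_split_measureI sp2 _ mN N0)//.
by rewrite !setTI ge0_muleDl ?mule_ge0 ?mu10 ?mu20// !muleA.
Qed.

Let nu_charge : {charge set T -> \bar R} := charge_of_finite_measure nu.

Lemma nonneg_charge_of_finite_measure : nonneg_charge nu_charge.
Proof. by move=> A mA; exact: measure_ge0. Qed.

Lemma density_split_self : density_split nu nu_charge (cst 1%R) set0.
Proof.
split => //; first exact: finite_measure_integrable_cst.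
move=> A mA; rewrite setI0 charge0 adde0.
by rewrite [RHS](_ : _ = \int[nu]_(x in A) cst 1 x)// integral_cst// mul1e.
Qed.

(** Mass added to [nu] costs at most the asymptotic slope per unit: by [generator_le_linear] on the
    density part, and exactly that on the singular part. *)
Lemma divergence_add_le mu (a : R) : nonneg_charge mu -> (0 <= a)%R ->
  divergence phi (cadd (cscale 1 nu_charge) (cscale a mu)) nu <=
  a%:E * (mu setT * slope_pinfty phi).
Proof.
move=> mu0 a0; have [p [N sp]] := density_split_ex nu mu0.
have nu0 := nonneg_charge_of_finite_measure.
have sp' := density_split_lincomb nu0 mu0 ler01 a0 density_split_self sp.
rewrite (divergence_density_split _ sp' gphi); last first.
  exact: nonneg_charge_lincomb.
have [mN N0 ip p0 muE] := sp.
have mp : measurable_fun setT p by exact/measurable_EFinP/(measurable_int _ ip).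
have mps : measurable_fun setT (fun x => (p x)%:E * slope_pinfty phi).
  by apply: emeasurable_funM => //; exact/measurable_EFinP.
rewrite set0U /= /cadd/= /cscale/=.
rewrite /nu_charge [X in 1%:E * X](_ : _ = 0)// mule0 add0e.
rewrite (muE _ measurableT) setTI.
rewrite ge0_muleDl ?mu0//; last by apply: integral_ge0 => x _; rewrite lee_fin.
rewrite ge0_muleDr ?mule_ge0 ?mu0//; last first.
  by apply: integral_ge0 => x _; rewrite lee_fin.
apply: leeD; last by rewrite muleA.
rewrite -ge0_integralZr//; [|exact/measurable_EFinP|by move=> x _; rewrite lee_fin].
rewrite -ge0_integralZl//; last by move=> x _; rewrite mule_ge0// lee_fin.
apply: ge0_le_integral => //.
- by move=> x _; exact: dg_ge0 gphi _.
- apply: measurable_generator_comp.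
  by apply: measurable_funD => //; exact: measurable_funM.
- exact: measurable_funeM.
- move=> x _; rewrite mul1r muleA -EFinM; apply: generator_le_linear => //.
  by rewrite mulr_ge0.
Qed.

End divergence_combinations.

(** * Consequences of decomposability *)

Section decomposable_theory.
Local Open Scope charge_scope.
Context d (T : measurableType d) (R : realType).
Implicit Types (mu : {charge set T -> \bar R}) (p h : T -> R).
Variable nu : {finite_measure set T -> \bar R}.

Lemma induced_charge_split p (ip : nu.-integrable setT (EFin \o p)) :
  (forall x, (0 <= p x)%R) -> density_split nu (induced_charge ip) p set0.
Proof.
by move=> p0; split => // A mA; rewrite setI0 charge0 adde0.
Qed.

Variables (X : set ({charge set T -> \bar R})) (Y : set (T -> R)).
Hypothesis dec : decomposable nu X Y.

Lemma decomposable_density p (C : R) : measurable_fun setT p ->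
  (forall x, (0 <= p x <= C)%R) ->
  exists mu, [/\ X mu, nonneg_charge mu & density_split nu mu p set0].
Proof.
move=> mp pC.
have p0 x : (0 <= p x)%R by have /andP[] := pC x.
have ip : nu.-integrable setT (EFin \o p).
  apply: (@le_integrable _ _ _ nu setT measurableT _ (cst C%:E)) => //.
  - exact/measurable_EFinP.
  - move=> x _; rewrite lee_fin ger0_norm// ger0_norm; first by case/andP: (pC x).
    by case/andP: (pC x) => /le_trans; apply.
  - exact: finite_measure_integrable_cst.
pose mu : {charge set T -> \bar R} := induced_charge ip.
have munu : mu `<< nu.
  apply/null_content_dominatesP => A mA A0.
  by apply: null_set_integral => //; apply: measurable_funTS; exact/measurable_EFinP.
have pRN : ae_eq nu setT ('d mu '/d nu) (EFin \o p).
  apply: integral_ae_eq => //; first exact: Radon_Nikodym_integrable.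
    exact/measurable_EFinP.
  by move=> E _ mE; rewrite -Radon_Nikodym_integral.
exists mu; split; last exact: induced_charge_split.
  apply: (dec_density dec munu); split.
    exact: measurableT_comp (measurable_int _ (Radon_Nikodym_integrable munu)).
  (* The derivative lies in [[0, C]] almost everywhere, and a point of absolute value above [C + 1]
     has a neighborhood of radius 1 that misses this interval. *)
  exists (C + 1)%R; split; first exact: num_real.
  move=> M CM x xim; apply: contrapT => /negP; rewrite -ltNge => Mx.
  have mB : measurable ((fun z => fine (('d mu '/d nu) z)) @^-1`
      `](x - 1)%R, (x + 1)%R[%classic).
    rewrite -[X in measurable X]setTI.
    apply: (measurableT_comp _ (measurable_int _
      (Radon_Nikodym_integrable munu))) => //.
  apply: (xim 1%R ltr01); split => //.
  have [Z [mZ Z0 HZ]] := pRN.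
  apply: (subset_measure0 mB mZ _ Z0).
  move=> z /=; rewrite in_itv/= => zx; apply: HZ => /= /(_ I) zp.
  move: zx; rewrite zp/=; have := pC z.
  by case: (ler0P x) Mx => x0; lra.
by move=> A mA; apply: integral_ge0 => x _; rewrite lee_fin.
Qed.

Lemma null_ideal_eq0 mu A : X mu -> null_ideal X A -> mu A = 0.
Proof.
move=> Xmu [mA /(_ _ Xmu) A0]; apply/eqP.
by rewrite -abse_eq0 eq_le abse_ge0 andbT -A0 abse_le_total_variation.
Qed.

Lemma null_idealS A B : measurable A -> A `<=` B -> null_ideal X B ->
  null_ideal X A.
Proof.
move=> mA AB [mB B0]; split => // mu Xmu.
exact: subset_measure0 mA mB AB (B0 _ Xmu).
Qed.

(** The essential range is defined point by point, so a countable cover is extracted: a value above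
    [c] is outside the range, hence in an interval with rational endpoints whose preimage is in the
    ideal. [F] enumerates these preimages. *)
Lemma ess_sup_ideal_null mu h (c : R) : X mu -> nonneg_charge mu ->
  measurable_fun setT h -> ess_sup_ideal (null_ideal X) h <= c%:E ->
  mu [set x | (c < h x)%R] = 0.
Proof.
move=> Xmu mu0 mh hc.
have mpre a b : measurable (h @^-1` `]a, b[%classic).
  by rewrite -[X in measurable X]setTI; exact: mh.
pose F n : set T := if unpickle n is Some (a, b) then
  [set x | null_ideal X (h @^-1` `]ratr a, ratr b[%classic) /\
           (h @^-1` `]ratr a, ratr b[%classic) x] else set0 : set T.
have F0 n : (charge_pos mu).-negligible (F n).
  rewrite /F; case: (unpickle n) => [[a b]|]; last exact: negligible_set0.
  have [HN|HN] := pselect (null_ideal X (h @^-1` `]ratr a, ratr b[%classic)).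
    exists (h @^-1` `]ratr a, ratr b[%classic); split => //.
      by rewrite charge_posE//; exact: null_ideal_eq0.
    by move=> x [].
  rewrite (_ : [set x | _] = set0); first exact: negligible_set0.
  by apply/seteqP; split => // x [].
have mc : measurable [set x | (c < h x)%R].
  have -> : [set x | (c < h x)%R] = h @^-1` `]c, +oo[%classic.
    by apply/seteqP; split => x /=; rewrite in_itv/= andbT.
  by rewrite -[X in measurable X]setTI; exact: mh.
rewrite -charge_posE//; apply/(negligibleP (charge_pos mu) mc).
apply: (negligibleS _ (negligible_bigcup F0)) => x /= cx.
have /existsNP[e /not_implyP[e0 /contrapT HN]] :
    ~ ess_im (null_ideal X) h (h x).
  move=> hx; have : (h x)%:E <= c%:E.
    by apply: le_trans hc; apply: ereal_sup_ubound; exists (h x).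
  by rewrite lee_fin leNgt cx.
have [a] := @rat_in_itvoo R (h x - e)%R (h x) (ltac:(lra)).
rewrite in_itv/= => /andP[a1 a2].
have [b] := @rat_in_itvoo R (h x) (h x + e)%R (ltac:(lra)).
rewrite in_itv/= => /andP[b1 b2].
exists (pickle (a, b)); first exact: I.
rewrite /F pickleK; split.
  apply: null_idealS HN => // y /=; rewrite !in_itv/= => /andP[y1 y2].
  by rewrite (lt_trans a1 y1) (lt_trans y2 b2).
by rewrite /= in_itv/= a2 b1.
Qed.

End decomposable_theory.

(** * The optimal lower bound *)

Section optimal_lower_bound.
Context (R : realType) d (T : measurableType d) (phi : R -> \bar R).
Variables (nu : probability T R) (X : set ({charge set T -> \bar R})).
Variable Y : set (T -> R).
Implicit Types (mu : {charge set T -> \bar R}) (g h p : T -> R) (l : R).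
Hypotheses (gphi : divergence_generator phi) (dec : decomposable nu X Y).

Let nuc : {charge set T -> \bar R} := charge_of_finite_measure nu.

Let Xnu : X nuc. Proof. exact: dec_nu dec. Qed.

Let nuc0 : nonneg_charge nuc. Proof. exact: nonneg_charge_of_finite_measure. Qed.

Let psi_star := conjugate (recenter phi).

Lemma integrable_pairing mu h : X mu -> nonneg_charge mu -> Y h ->
  (charge_pos mu).-integrable setT (EFin \o h).
Proof.
move=> Xmu mu0 Yh; apply: (integrable_charge_pos mu0) => [A mA|].
  exact: charge_posE.
by have [+ _ _] := dec_duality dec; apply.
Qed.

Lemma integrable_base h : Y h -> nu.-integrable setT (EFin \o h).
Proof.
move=> Yh; apply: (integrable_charge_pos nuc0) => //.
by have [+ _ _] := dec_duality dec; apply.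
Qed.

Lemma charge_integral_pos mu h : nonneg_charge mu ->
  charge_integral mu h = (\int[charge_pos mu]_x h x)%R.
Proof. by move=> mu0; apply: charge_integralE => // A mA; exact: charge_posE. Qed.

Lemma charge_integral_base h : charge_integral nuc h = (\int[nu]_x h x)%R.
Proof. exact: charge_integralE. Qed.

Lemma decomposable_scale t h : Y h -> Y (fun x => t * h x)%R.
Proof. by have [_ _ _ +] := dec_Y dec; apply. Qed.

(** The constant [l] enters [Y] through [dec_Linfty]: a point at distance more than 1 from [l] has a
    neighborhood with empty preimage. *)
Lemma decomposable_shift l h : Y h -> Y (fun x => h x + l)%R.
Proof.
move=> Yh; have [_ _ + _] := dec_Y dec; apply => //.
apply: (dec_Linfty dec); split => //.
exists (`|l| + 1)%R; split; first exact: num_real.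
move=> M lM x xim; apply: contrapT => /negP; rewrite -ltNge => Mx.
apply: (xim 1%R ltr01).
rewrite (_ : _ @^-1` _ = set0); first by split => // mu _; exact: measure0.
apply/seteqP; split => // z /=; rewrite in_itv/= => lx.
have : (`|x - l| < 1)%R by rewrite ltr_norml; lra.
have := ler_normD (x - l)%R l; rewrite subrK; lra.
Qed.

Lemma charge_integral_shift mu h l : X mu -> nonneg_charge mu -> Y h ->
  charge_integral mu (fun x => h x + l)%R =
  (charge_integral mu h + l * fine (mu setT))%R.
Proof.
move=> Xmu mu0 Yh; rewrite !charge_integral_pos// RintegralD//.
- by rewrite Rintegral_cst//; congr (_ + _ * fine _)%R; exact: charge_posE.
- exact: integrable_pairing.
- exact: finite_measure_integrable_cst.
Qed.

Lemma base_integral_shift h l : Y h ->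
  (\int[nu]_x (h x + l) = \int[nu]_x h x + l)%R.
Proof.
move=> Yh; rewrite -!charge_integral_base charge_integral_shift//.
by rewrite [nuc setT]probability_setT mulr1.
Qed.

Lemma charge_integral_split mu p N h : X mu -> nonneg_charge mu ->
  density_split nu mu p N -> Y h ->
  nu.-integrable setT (fun x => (h x * p x)%:E) /\
  (charge_integral mu h)%:E =
  \int[nu]_x (h x * p x)%:E + \int[charge_pos mu]_(x in N) (h x)%:E.
Proof.
move=> Xmu mu0 sp Yh.
have [|ihp <-] := density_split_change_of_variables sp _
  (integrable_pairing Xmu mu0 Yh); first by move=> A mA; exact: charge_posE.
split => //; rewrite charge_integral_pos// /Rintegral fineK//.
by apply: integrable_fin_num => //; exact: integrable_pairing.
Qed.

Lemma measurable_conjugate_comp h : measurable_fun setT h ->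
  measurable_fun setT (fun x => psi_star (h x)).
Proof.
move=> mh; apply: (measurableT_comp _ mh).
by apply: lower_semicontinuous_measurable; exact: conjugate_lsc.
Qed.

(* The pointwise Fenchel-Young inequality bounds the absolutely continuous
   part; on the singular part, [h + l <= slope_pinfty phi] outside a set of the
   null ideal of [X]. *)
Lemma fenchel_young mu h l : prob_charges X mu -> Y h ->
  l%:E + ess_sup_ideal (null_ideal X) h <= slope_pinfty phi ->
  (charge_integral mu h - \int[nu]_x h x)%:E - divergence phi mu nu <=
  \int[nu]_x psi_star (h x + l).
Proof.
move=> [Xmu mu0 mu1] Yh hl.
pose k x := (h x + l)%R; have Yk : Y k by exact: decomposable_shift.
(* Both [mu] and [nu] have mass 1, so the shift by [l] cancels. *)
have -> : (charge_integral mu h - \int[nu]_x h x =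
    charge_integral mu k - \int[nu]_x k x)%R.
  by rewrite charge_integral_shift// base_integral_shift// mu1/=; lra.
have mk : measurable_fun setT k by exact: dec_measurable dec _ Yk.
have mh : measurable_fun setT h by exact: dec_measurable dec _ Yh.
have [p [N sp]] := density_split_ex nu mu0.
have [mN N0 ip p0 muE] := sp.
have mp : measurable_fun setT p by exact/measurable_EFinP/(measurable_int _ ip).
have [ikp kE] := charge_integral_split Xmu mu0 sp Yk.
have ik := integrable_base Yk.
have s0 := slope_pinfty_ge0 gphi.
rewrite (divergence_density_split mu0 sp gphi).
set Dp := \int[nu]_x phi (p x).
have Dp0 : 0 <= Dp by apply: integral_ge0 => x _; exact: dg_ge0 gphi _.
have Psi0 : 0 <= \int[nu]_x psi_star (k x).
  by apply: integral_ge0 => x _; exact: conjugate_recenter_ge0.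
have ac : \int[nu]_x ((p x - 1) * k x)%:E <= \int[nu]_x psi_star (k x) + Dp.
  have mf : measurable_fun setT (fun x => ((p x - 1) * k x)%:E).
    by apply/measurable_EFinP/measurable_funM => //; exact: measurable_funB.
  rewrite -ge0_integralD//; last 4 first.
  - by move=> x _; exact: conjugate_recenter_ge0.
  - exact: measurable_conjugate_comp.
  - by move=> x _; exact: dg_ge0 gphi _.
  - exact: measurable_generator_comp.
  (* Only the positive part is compared: the bound is nonnegative and its integral may be
     infinite. *)
  rewrite [leLHS]integralE; apply: (@le_trans _ _
    (\int[nu]_x (fun x => ((p x - 1) * k x)%:E)^\+ x)).
    rewrite -[leRHS]adde0; apply: leeD => //; rewrite leeNl oppe0.
    exact: integral_ge0.
  apply: ge0_le_integral => //.
  - exact: measurable_funepos.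
  - apply: emeasurable_funD; first exact: measurable_conjugate_comp.
    exact: measurable_generator_comp.
  - move=> x _; rewrite funeposE ge_max adde_ge0 ?andbT.
    + exact: conjugate_recenter_ge.
    + exact: conjugate_recenter_ge0.
    + exact: dg_ge0 gphi _.
have sing : \int[charge_pos mu]_(x in N) (k x)%:E <= mu N * slope_pinfty phi.
  (* With an infinite slope, the right side is [+oo] unless [N] is [mu]-null, and then both sides
     vanish. With a finite slope [s], [h + l <= s] off a [mu]-null set. *)
  case sE : (slope_pinfty phi) s0 hl => [s| |]// s0 hl; last first.
    have : 0 <= mu N by exact: mu0.
    rewrite le_eqVlt => /orP[/eqP mN0|mN0]; last by rewrite gt0_muley// leey.
    rewrite -mN0 mul0e null_set_integral//; first exact/measurable_funTS/measurable_EFinP.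
    exact: etrans (charge_posE mu0 mN) (esym mN0).
  have mZ : measurable [set x | (s - l < h x)%R].
    have -> : [set x | (s - l < h x)%R] = h @^-1` `](s - l)%R, +oo[%classic.
      by apply/seteqP; split => x /=; rewrite in_itv/= andbT.
    by rewrite -[X in measurable X]setTI; exact: mh.
  have Z0 : charge_pos mu [set x | (s - l < h x)%R] = 0.
    rewrite charge_posE//; apply: (ess_sup_ideal_null Xmu) => //.
    by rewrite EFinB leeBrDr// addeC.
  have iN : (charge_pos mu).-integrable N (fun x => (k x)%:E).
    by apply: integrableS (integrable_pairing Xmu mu0 Yk).
  rewrite (negligible_integral mZ mN iN Z0).
  have mNZ : measurable (N `\` [set x | (s - l < h x)%R]) by exact: measurableD.
  apply: (@le_trans _ _ (\int[charge_pos mu]_(x in N `\` [set x | (s - l < h x)%R]) (cst s%:E x))).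
    apply: le_integral => //.
    - by apply: integrableS iN => //; exact: subDsetl.
    - exact: finite_measure_integrable_cst.
    - move=> x; rewrite inE => -[_ /= /negP]; rewrite -leNgt lee_fin /k; lra.
  rewrite integral_cst// muleC; apply: lee_wpmul2r => //=.
  rewrite -(charge_posE mu0 mN).
  by apply: le_measure; rewrite ?inE//; exact: subDsetl.
have -> : (charge_integral mu k - \int[nu]_x k x)%:E =
    \int[nu]_x ((p x - 1) * k x)%:E + \int[charge_pos mu]_(x in N) (k x)%:E.
  rewrite EFinB kE /Rintegral fineK; last exact: integrable_fin_num.
  rewrite addeAC -integralB//; congr (_ + _).
  by apply: eq_integral => x _; rewrite -EFinB; congr EFin; ring.
have [->|oo] := eqVneq (Dp + mu N * slope_pinfty phi) +oo.
  by rewrite addeNy leNye.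
rewrite leeBlDr; last first.
  by rewrite ge0_fin_numE ?ltey// adde_ge0// mule_ge0// mu0.
by have := leeD ac sing; rewrite -[X in _ <= X -> _]addeA.
Qed.

Lemma Phi_star_le_cumulant g t : Y g ->
  Phi_star phi X nu (fun x => t * g x)%R <= cumulant phi (null_ideal X) nu g t.
Proof.
move=> Yg; apply: ge_ereal_sup => _ [mu Xmu <-].
apply: le_ereal_inf_tmp => _ [l hl <-].
by apply: fenchel_young => //; exact: decomposable_scale.
Qed.

(** * Existence and admissibility of the multiplier *)

Lemma generator_near1 : exists2 e : R, (0 < e)%R &
  forall x, (`|x| <= e)%R -> phi (1 + x)%R < +oo.
Proof.
have [e /= e0 eP] := dg_dom gphi.
exists (e / 2)%R => [|x xe]; first by rewrite divr_gt0.
by apply: eP; rewrite /ball_/= opprD addNKr normrN; lra.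
Qed.

(* The multiplier [l] of the constraint [mu setT = 1] is the slope of a
   supporting line of the value function of the problem with total mass
   [1 + a], which is finite for [a] close to [0]. *)
Lemma mass_multiplier h (r : R) : Y h -> Phi_star phi X nu h = r%:E ->
  exists l, forall mu, X mu -> nonneg_charge mu ->
    (charge_integral mu (fun x => h x + l)%R)%:E <=
    divergence phi mu nu + (r + \int[nu]_x (h x + l))%:E.
Proof.
move=> Yh hr.
(* Pairs realized by a charge stand in for the value function, whose infimum might be [-oo] or
   unattained. *)
pose S : set (R * R) := [set av | exists mu, [/\ X mu, nonneg_charge mu,
  mu setT = (1 + av.1)%:E &
  divergence phi mu nu <= (av.2 + charge_integral mu h)%:E]].
have [Xext _ Xadd Xscale] := dec_X dec.
have cS : convex_region S.
  move=> [a v] [b w] t [mu1 [/= X1 mu10 m1 D1]] [mu2 [/= X2 mu20 m2 D2]] t01.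
  have /andP[t0] := t01; rewrite -subr_ge0 => t1.
  have i1 : (Defs.total_variation mu1).-integrable setT (EFin \o h).
    by have [+ _ _] := dec_duality dec; apply.
  have i2 : (Defs.total_variation mu2).-integrable setT (EFin \o h).
    by have [+ _ _] := dec_duality dec; apply.
  exists (cadd (cscale t mu1) (cscale (1 - t) mu2)); split.
  - by apply: Xadd; exact: Xscale.
  - exact: nonneg_charge_lincomb.
  - rewrite /= /cadd/= /cscale [mu1 _]m1 [mu2 _]m2 -!EFinM -EFinD.
    by congr EFin; ring.
  - apply: (le_trans (divergence_convex nu gphi mu10 mu20 t01)).
    rewrite charge_integral_lincomb//=.
    have -> : (t * v + (1 - t) * w + (t * charge_integral mu1 h +
        (1 - t) * charge_integral mu2 h) =
      t * (v + charge_integral mu1 h) + (1 - t) * (w + charge_integral mu2 h))%R.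
      by ring.
    by rewrite [leRHS]EFinD !(EFinM _ (_ + _)); apply: leeD; apply: lee_wpmul2l.
have S0 v : S (0%R, v) -> (- r - \int[nu]_x h x <= v)%R.
  move=> [mu [/= Xmu mu0]]; rewrite addr0 => mu1 Dv.
  have : (charge_integral mu h - \int[nu]_x h x)%:E - divergence phi mu nu <=
      r%:E.
    by rewrite -hr; apply: ereal_sup_ubound; exists mu.
  have := divergence_ge0 nu gphi mu0; move: Dv.
  case: (divergence phi mu nu) => [D| |]//.
  by rewrite -EFinB !lee_fin; lra.
have [e e0 eP] := generator_near1.
(* The charge with constant density [1 + a] has divergence [phi (1 + a)], so masses on both sides of
   1 are feasible. *)
have Spt a : (`|a| <= e)%R -> exists v, S (a, v).
  move=> ae; have a1 : (0 <= 1 + a)%R.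
    rewrite leNgt; apply/negP => /(dg_neg gphi) H.
    by have := eP _ ae; rewrite H.
  have [|mu [Xmu mu0 sp]] := decomposable_density dec
    (@measurable_cst _ _ T R setT (1 + a)%R) (C := (1 + a)%R).
    by move=> x; rewrite a1 lexx.
  exists (fine (phi (1 + a)%R) - charge_integral mu h)%R, mu; split => //=.
    have [_ _ _ _ ->//] := sp.
    rewrite setI0 charge0 adde0.
    rewrite [LHS](_ : _ = \int[nu]_x (cst (1 + a)%:E x))// integral_cst//.
    by rewrite [X in _ * X](probability_setT nu : _ = 1) mule1.
  rewrite (divergence_density_split mu0 sp gphi) charge0 mul0e adde0 subrK.
  rewrite fineK; last by rewrite ge0_fin_numE ?eP//; exact: dg_ge0 gphi _.
  rewrite [leLHS](_ : _ = \int[nu]_x (cst (phi (1 + a)%R) x))// integral_cst//.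
  by rewrite [X in _ * X](probability_setT nu : _ = 1) mule1.
have [v Sv] := Spt (- e)%R (ltac:(by rewrite normrN gtr0_norm)).
have [w Sw] := Spt e (ltac:(by rewrite gtr0_norm)).
have [|k kP] := supporting_line_interior cS S0 Sv _ Sw e0; first by lra.
exists k => mu Xmu mu0.
rewrite charge_integral_shift// base_integral_shift//.
have := divergence_ge0 nu gphi mu0.
case DE : (divergence phi mu nu) => [D| |]// D0; last by rewrite addye ?leey.
have mfin : mu setT \is a fin_num by exact: fin_num_measure.
have /kP : S (fine (mu setT) - 1, D - charge_integral mu h)%R.
  by exists mu; split => //=; rewrite ?subrKC ?fineK ?subrK ?DE.
by rewrite -EFinD lee_fin; lra.
Qed.

Lemma Phi_star_ge0 h : 0 <= Phi_star phi X nu h.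
Proof.
apply: ereal_sup_ubound; exists nuc; first by split => //; exact: probability_setT.
rewrite charge_integral_base subrr.
rewrite (divergence_density_split nuc0 (density_split_self nu) gphi).
rewrite charge0 mul0e adde0 sub0e; under eq_integral do rewrite (dg1 gphi).
by rewrite integral0 oppe0.
Qed.

(** If [h + l] exceeded a finite slope [s] by [e] on a set charged by [X], mass placed there would
    gain at least [s + e] per unit and cost at most [s]. In the test with [nu + n mu] the
    contributions of [nu] cancel, and the net gain, linear in [n], would have to stay below [r]. *)
Lemma multiplier_admissible h l (r : R) : Y h ->
  (forall mu, X mu -> nonneg_charge mu ->
    (charge_integral mu (fun x => h x + l)%R)%:E <=
    divergence phi mu nu + (r + \int[nu]_x (h x + l))%:E) ->
  l%:E + ess_sup_ideal (null_ideal X) h <= slope_pinfty phi.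
Proof.
move=> Yh hP; rewrite leNgt; apply/negP.
have := slope_pinfty_ge0 gphi.
case sE : (slope_pinfty phi) => [s| |]// s0 sl; last by rewrite ltNge leey in sl.
have : (s - l)%:E < ess_sup_ideal (null_ideal X) h.
  by rewrite EFinB lteBlDr// addeC.
move=> /ereal_sup_gt[_ [x xim <-]]; rewrite lte_fin => slx.
(* Half of the excess, so that [h + l] stays above [s + e] on the whole of [A]. *)
pose e := ((x - (s - l)) / 2)%R.
have e0 : (0 < e)%R by rewrite divr_gt0// subr_gt0.
pose A := h @^-1` `](x - e)%R, (x + e)%R[%classic.
have mh : measurable_fun setT h by exact: dec_measurable dec _ Yh.
have mA : measurable A by rewrite -[X in measurable X]setTI; exact: mh.
have [mu [Xmu mu0 munz muA]] := dec_supported dec mA (xim e e0).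
pose k z := (h z + l)%R; have Yk : Y k by exact: decomposable_shift.
have [Xext _ Xadd Xscale] := dec_X dec.
have mfin : mu setT \is a fin_num by exact: fin_num_measure.
set M := fine (mu setT).
have M0 : (0 < M)%R.
  rewrite fine_gt0//; apply/andP; split; last by rewrite ltey_eq mfin.
  rewrite lt0e mu0// andbT; apply/eqP => muT0; apply: munz => B mB.
  have : mu B <= mu setT.
    rewrite -!(charge_posE mu0)//; apply: le_measure; rewrite ?inE//.
  by rewrite muT0 => B0; apply/eqP; rewrite eq_le B0 mu0.
have kM : ((x - e + l) * M <= charge_integral mu k)%R.
  rewrite charge_integral_pos// -lee_fin /Rintegral fineK; last first.
    by apply: integrable_fin_num => //; exact: integrable_pairing.
  have ik := integrable_pairing Xmu mu0 Yk.
  have mAC : measurable (~` A) by exact: measurableC.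
  rewrite (negligible_integral mAC measurableT ik); last first.
    exact: etrans (charge_posE mu0 mAC) muA.
  rewrite setDE setCK setTI.
  apply: (@le_trans _ _ (\int[charge_pos mu]_(z in A) (cst (x - e + l)%:E z))).
    rewrite integral_cst// EFinM /M fineK// (chargeDI mu measurableT mA).
    rewrite setTD muA add0e setTI; by rewrite -(charge_posE mu0 mA).
  apply: le_integral => //.
  - exact: finite_measure_integrable_cst.
  - exact: integrableS ik.
  - move=> z; rewrite inE /A/= in_itv/= => /andP[z1 _].
    by rewrite lee_fin /k lerD2r ltW.
have ceq : (x - e + l = s + e)%R by rewrite /e; lra.
have nP (n : nat) : (n%:R * (e * M) <= r)%R.
  have n0 : (0 <= n%:R :> R)%R by [].
  pose mun : {charge set T -> \bar R} :=
    cadd (cscale 1 nuc) (cscale n%:R mu).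
  have mun0 : nonneg_charge mun by exact: nonneg_charge_lincomb.
  have Xmun : X mun by apply: Xadd; exact: Xscale.
  have := hP _ Xmun mun0; rewrite charge_integral_lincomb//; last 2 first.
  - by have [+ _ _] := dec_duality dec; apply.
  - by have [+ _ _] := dec_duality dec; apply.
  rewrite charge_integral_base mul1r.
  have := divergence_add_le nu gphi mu0 n0; rewrite sE -(fineK mfin) -/M -!EFinM.
  have := divergence_ge0 nu gphi mun0.
  rewrite -/mun; case: (divergence phi mun nu) => [D| |]//.
  rewrite -EFinD !lee_fin => _ DM H.
  have := ler_wpM2l n0 kM; rewrite ceq.
  by move: H; rewrite /k; lra.
have := nP (Num.truncn (r / (e * M))).+1.
apply/negP; rewrite -ltNge -ltr_pdivrMr; first exact: truncnS_gt.
exact: mulr_gt0.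
Qed.

(** * Bounded densities that nearly maximize the Young gap *)

Section rational_densities.
Variables (k : T -> R) (q : nat -> R).
Hypotheses (mk : measurable_fun setT k) (q_dom : forall n, phi (q n) < +oo).

Definition young_gap (y x : R) := ((x - 1) * y - fine (phi x))%R.

(* A maximizer of [young_gap (k z)] over [1, q 0, ..., q n.-1]. *)
Fixpoint argmax_density (n : nat) (z : T) : R :=
  if n is m.+1 then
    let x := argmax_density m z in
    if (young_gap (k z) x < young_gap (k z) (q m))%R then q m else x
  else 1%R.

Let phi_fin x : phi x < +oo -> phi x \is a fin_num.
Proof. by move=> ?; rewrite ge0_fin_numE//; exact: dg_ge0 gphi _. Qed.

Lemma generator_dom_ge0 x : phi x < +oo -> (0 <= x)%R.
Proof. by rewrite leNgt => xoo; apply/negP => /(dg_neg gphi) H; rewrite H in xoo. Qed.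

Lemma young_gap_le y x : phi x < +oo -> (young_gap y x)%:E <= psi_star y.
Proof.
move=> /phi_fin xfin; rewrite /young_gap EFinB fineK// leeBlDr//.
exact: conjugate_recenter_ge.
Qed.

(** Only finitely many values occur, all in the domain of [phi]. Boundedness of the density puts the
    charge in [X]; boundedness of [phi] along it makes the divergence finite. *)
Lemma argmax_density_bound n : exists C : R, forall z,
  [/\ (0 <= argmax_density n z <= C)%R, phi (argmax_density n z) < +oo
    & phi (argmax_density n z) <= C%:E].
Proof.
elim: n => [|n [C IH]].
  by exists 1%R => z; rewrite /= (dg1 gphi) ler01 lexx lee_fin.
exists (Num.max C (Num.max (q n) (fine (phi (q n)))))%R => z /=.
case: ifPn => _.
  rewrite generator_dom_ge0// q_dom; split => //.
    by rewrite !le_max lexx orbT.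
  by rewrite -[leLHS](fineK (phi_fin (q_dom n))) lee_fin !le_max lexx !orbT.
have [/andP[-> pC] -> phiC] := IH z; split => //=; first by rewrite le_max pC.
by apply: le_trans phiC _; rewrite lee_fin le_max lexx.
Qed.

Lemma measurable_young_gap (f g : T -> R) : measurable_fun setT f ->
  measurable_fun setT g -> measurable_fun setT (fun z => young_gap (f z) (g z)).
Proof.
move=> mf mg; apply: measurable_funB.
  by apply: measurable_funM => //; exact: measurable_funB.
apply: measurableT_comp => //; apply: measurableT_comp => //.
exact: lower_semicontinuous_measurable (dg_lsc gphi).
Qed.

Lemma measurable_argmax_density n : measurable_fun setT (argmax_density n).
Proof.
elim: n => [|n IH]; first exact: measurable_cst.
apply: measurable_fun_if => //.
- apply: measurable_fun_ltr; first exact: measurable_young_gap.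
  exact: measurable_young_gap.
- exact: measurable_funTS.
Qed.

Lemma young_gap_argmax_nd z : nondecreasing_seq
  (fun n => young_gap (k z) (argmax_density n z)).
Proof.
apply/nondecreasing_seqP => n /=; case: ifPn => // /ltW//.
Qed.

Lemma young_gap_argmax_ge n z :
  (young_gap (k z) (q n) <= young_gap (k z) (argmax_density n.+1 z))%R.
Proof. by rewrite /=; case: ifPn => //; rewrite -leNgt. Qed.

End rational_densities.

(** An interchange of supremum and integral without measurable selection: the conjugate is the
    increasing limit of gaps at finite maxima, and the hypothesis at each such density bounds the
    integral of its gap by [r]. *)
Lemma multiplier_integral_le h l (r : R) : Y h ->
  (forall mu, X mu -> nonneg_charge mu ->
    (charge_integral mu (fun x => h x + l)%R)%:E <=
    divergence phi mu nu + (r + \int[nu]_x (h x + l))%:E) ->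
  \int[nu]_x psi_star (h x + l) <= r%:E.
Proof.
move=> Yh hP.
pose k z := (h z + l)%R; have Yk : Y k by exact: decomposable_shift.
have mk : measurable_fun setT k by exact: dec_measurable dec _ Yk.
(* An enumeration of the rationals in the domain of [phi]; all other indices are sent to 1, where
   [phi] vanishes. *)
pose q n : R := if unpickle n is Some x then
  if phi (ratr x) < +oo then ratr x else 1%R else 1%R.
have q_dom n : phi (q n) < +oo.
  rewrite /q; case: (unpickle n) => [x|]; last by rewrite (dg1 gphi).
  by case: ifPn => // _; rewrite (dg1 gphi).
pose p := argmax_density k q.
pose v n z := (young_gap (k z) (p n z))%:E.
have mp n : measurable_fun setT (p n) by exact: measurable_argmax_density.
have mv n : measurable_fun setT (v n).
  by apply/measurable_EFinP; exact: measurable_young_gap.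
have v_nd z : nondecreasing_seq (v ^~ z).
  by move=> m n mn; rewrite lee_fin; exact: young_gap_argmax_nd.
(* The maxima start from the density 1, whose gap is 0, which gives the nonnegativity needed for
   monotone convergence. *)
have v0 n z : 0 <= v n z.
  apply: le_trans (v_nd z 0%N n (leq0n n)).
  by rewrite /v /young_gap /= (dg1 gphi) subrr mul0r subrr.
have v_lim z : psi_star (k z) = limn (v ^~ z).
  have cv := ereal_nondecreasing_cvgn (v_nd z).
  rewrite (cvg_lim _ cv)//; apply/eqP; rewrite eq_le; apply/andP; split.
    apply: lee_real_minorants => [|x /(conjugate_recenter_rat gphi)[y yoo xy]].
      exact: conjugate_recenter_ge0.
    (* The candidate of index [pickle y] enters the maximum at the next stage. *)
    apply: (@le_trans _ _ (v (pickle y).+1 z)); last first.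
      by apply: ereal_sup_ubound; exists (pickle y).+1.
    rewrite lee_fin; apply: le_trans (young_gap_argmax_ge _ _ _ _).
    by rewrite /q pickleK yoo; exact: ltW.
  apply: ge_ereal_sup => _ [n _ <-]; apply: young_gap_le.
  by have [C /(_ z)[]] := argmax_density_bound k q_dom n.
under eq_integral do rewrite v_lim.
rewrite monotone_convergence//.
apply: lime_le.
  apply: ereal_nondecreasing_is_cvgn => m n mn; apply: ge0_le_integral => //.
  by move=> z _; exact: v_nd.
apply: nearW => n.
have [C HC] := argmax_density_bound k q_dom n.
have [|mu [Xmu mu0 sp]] := decomposable_density dec (mp n) (C := C).
  by move=> z; have [] := HC z.
have [ikp kE] := charge_integral_split Xmu mu0 sp Yk.
have ik := integrable_base Yk.
have iphi : nu.-integrable setT (fun z => phi (p n z)).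
  apply: (@le_integrable _ _ _ nu setT measurableT _ (cst C%:E)).
  - apply: measurableT_comp => //.
    exact: lower_semicontinuous_measurable (dg_lsc gphi).
  - move=> z _; have [/andP[z0 zC] _ phiC] := HC z.
    rewrite gee0_abs; last exact: dg_ge0 gphi _.
    by rewrite /= ger0_norm// (le_trans z0).
  - exact: finite_measure_integrable_cst.
have vE z : v n z = (k z * p n z)%:E - (k z)%:E - phi (p n z).
  have [_ zoo _] := HC z.
  rewrite /v /young_gap EFinB fineK; last first.
    by rewrite ge0_fin_numE//; exact: dg_ge0 gphi _.
  by rewrite -EFinB; congr (EFin _ - _); ring.
under eq_integral do rewrite vE.
rewrite integralB//; last exact: integrableB.
rewrite integralB//.
have := hP _ Xmu mu0.
rewrite (divergence_density_split mu0 sp gphi) charge0 mul0e adde0.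
have -> : \int[nu]_z (k z * p n z)%:E = (charge_integral mu k)%:E.
  by rewrite kE integral_set0 adde0.
have -> : \int[nu]_z (k z)%:E = (\int[nu]_z k z)%:E.
  by rewrite /Rintegral fineK//; exact: integrable_fin_num.
have Pf : \int[nu]_z phi (p n z) \is a fin_num by exact: integrable_fin_num.
by rewrite -(fineK Pf) -EFinD -!EFinB !lee_fin /k; lra.
Qed.

Lemma cumulant_le_Phi_star g t : Y g ->
  cumulant phi (null_ideal X) nu g t <= Phi_star phi X nu (fun x => t * g x)%R.
Proof.
move=> Yg; have Yh := decomposable_scale t Yg.
have := Phi_star_ge0 (fun x => t * g x)%R.
case rE : (Phi_star phi X nu (fun x => t * g x)%R) => [r| |]// _; last first.
  by rewrite leey.
have [l lP] := mass_multiplier Yh rE.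
apply: le_trans (multiplier_integral_le Yh lP).
apply: ereal_inf_lbound; exists l => //=.
exact: multiplier_admissible Yh lP.
Qed.

Lemma Phi_star_cumulant g t : Y g ->
  Phi_star phi X nu (fun x => t * g x)%R = cumulant phi (null_ideal X) nu g t.
Proof.
by move=> Yg; apply/eqP; rewrite eq_le Phi_star_le_cumulant// cumulant_le_Phi_star.
Qed.

Lemma charge_integral_scale mu h t : X mu -> nonneg_charge mu -> Y h ->
  charge_integral mu (fun x => t * h x)%R = (t * charge_integral mu h)%R.
Proof.
move=> Xmu mu0 Yh; rewrite !charge_integral_pos// RintegralZl//.
exact: integrable_pairing.
Qed.

(** * Convexity and conjugate of the lower bound function *)

Section lower_bound_function.
Variable g : T -> R.
Hypothesis Yg : Y g.

Let L := opt_lower_bound phi X nu g.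

Lemma opt_lower_bound_ge0 e : 0 <= L e.
Proof.
apply: le_ereal_inf_tmp => _ [mu [[_ mu0 _] _] <-].
exact: divergence_ge0.
Qed.

(** Near-minimizers are mixed, the constraints being affine. The endpoints come first because
    [0 * +oo = 0] would spoil the trivial bound when [L] is infinite at [x] or [y]. *)
Lemma econvex_opt_lower_bound : econvex L.
Proof.
move=> x y t t01; have /andP[] := t01.
rewrite le_eqVlt => /orP[/eqP <- _|t0].
  by rewrite subr0 mul0r mul1r add0r mul0e mul1e add0e.
rewrite -subr_ge0 le_eqVlt => /orP[/eqP s0|s0].
  have -> : t = 1%R by lra.
  by rewrite subrr mul0r mul1r addr0 mul0e mul1e adde0.
have [Lx|Lx] := eqVneq (L x) +oo.
  rewrite Lx gt0_muley ?lte_fin// addye ?leey//.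
  by rewrite gt_eqF// (lt_le_trans ltNy0)// mule_ge0 ?opt_lower_bound_ge0 ?lee_fin// ltW.
have [Ly|Ly] := eqVneq (L y) +oo.
  rewrite Ly gt0_muley ?lte_fin// addey ?leey//.
  by rewrite gt_eqF// (lt_le_trans ltNy0)// mule_ge0 ?opt_lower_bound_ge0 ?lee_fin// ltW.
have Lf z : L z != +oo -> L z \is a fin_num.
  by move=> Lz; rewrite ge0_fin_numE ?opt_lower_bound_ge0// ltey.
apply/lee_addgt0Pr => /= e e0.
have [_ [mu [[X1 mu0 mu1] mux] <-] Dx] := lb_ereal_inf_adherent e0 (Lf _ Lx).
have [_ [mu' [[X1' mu0' mu1'] muy] <-] Dy] := lb_ereal_inf_adherent e0 (Lf _ Ly).
have [_ _ Xadd Xscale] := dec_X dec.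
apply: (@le_trans _ _ (t%:E * (L x + e%:E) + (1 - t)%:E * (L y + e%:E))); last first.
  rewrite -(fineK (Lf _ Lx)) -(fineK (Lf _ Ly)).
  move: (fine (L x)) (fine (L y)) => u v.
  rewrite -[leLHS]/((t * (u + e) + (1 - t) * (v + e))%:E).
  by rewrite -[leRHS]/((t * u + (1 - t) * v + e)%:E) lee_fin; lra.
apply: (@le_trans _ _
  (t%:E * divergence phi mu nu + (1 - t)%:E * divergence phi mu' nu)).
  apply: le_trans (divergence_convex nu gphi mu0 mu0' t01).
  apply: ereal_inf_lbound; exists (cadd (cscale t mu) (cscale (1 - t) mu')) => //.
  split.
    split; first by apply: Xadd; exact: Xscale.
      by apply: nonneg_charge_lincomb => //; exact: ltW.
    rewrite /= /cadd/= /cscale [mu _]mu1 [mu' _]mu1' !mule1 -EFinD.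
    by congr EFin; lra.
  rewrite charge_integral_lincomb ?ltW//; last 2 first.
  - by have [+ _ _] := dec_duality dec; apply.
  - by have [+ _ _] := dec_duality dec; apply.
  by move: mux muy => <- <-; ring.
by apply: leeD; apply: lee_wpmul2l; rewrite ?lee_fin ltW.
Qed.

(** Sorting the probability charges by the value [e] of their constraint turns the supremum over
    charges into a supremum over [e] of [e * t - L e]. *)
Lemma conjugate_opt_lower_bound t :
  conjugate L t = Phi_star phi X nu (fun x => t * g x)%R.
Proof.
have slopeE mu : prob_charges X mu ->
    (charge_integral mu (fun x => t * g x) - \int[nu]_x (t * g x) =
     (charge_integral mu g - \int[nu]_x g x) * t)%R.
  move=> [Xmu mu0 _]; rewrite charge_integral_scale//.
  rewrite -(charge_integral_base (fun x => t * g x)%R).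
  by rewrite charge_integral_scale// charge_integral_base; ring.
apply/eqP; rewrite eq_le; apply/andP; split; last first.
  apply: ge_ereal_sup => _ [mu Xmu <-]; rewrite slopeE//.
  apply: le_trans (conjugate_ub _ _ _); apply: leeB => //.
  by apply: ereal_inf_lbound; exists mu.
apply: ge_ereal_sup => _ [x _ <-].
set P := Phi_star _ _ _ _; have : 0 <= P by exact: Phi_star_ge0.
case PE : P => [r| |]// _; last by rewrite leey.
have : (x * t - r)%:E <= L x.
  apply: le_ereal_inf_tmp => _ [mu [Xmu mux] <-].
  have : (x * t)%:E - divergence phi mu nu <= P.
    by rewrite -mux -slopeE//; apply: ereal_sup_ubound; exists mu.
  have := divergence_ge0 nu gphi (mu := mu) (ltac:(by case: Xmu)).
  rewrite PE; case: (divergence phi mu nu) => [D| |]// _; last by rewrite leey.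
  by rewrite -EFinB !lee_fin; lra.
case: (L x) => [y| |]//; last by rewrite leNye.
by rewrite -EFinB !lee_fin; lra.
Qed.

End lower_bound_function.

End optimal_lower_bound.

Unset Implicit Arguments.

Theorem theorem5p1p11 (R : realType) (d : measure_display)
    (T : measurableType d) (phi : R -> \bar R) (nu : probability T R)
    (X : set ({charge set T -> \bar R})) (Y : set (T -> R)) (g : T -> R) :
  (exists A : set T, [/\ measurable A, A <> set0 & A <> [set: T]]) ->
  divergence_generator phi ->
  decomposable nu X Y ->
  Y g ->
  let L := opt_lower_bound phi X nu g in
  let K := cumulant phi (null_ideal X) nu g in
  [/\ forall e : R, (edom L)° e -> L e = conjugate K e,
      lower_semicontinuous L <-> (forall e : R, strong_duality phi X nu g e)
    & lower_semicontinuous L -> forall e : R, L e = conjugate K e].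
Proof.
move=> _ gphi dec Yg L K.
have cL : econvex L := econvex_opt_lower_bound gphi dec Yg.
have L0 : forall e, 0 <= L e by move=> e; exact: opt_lower_bound_ge0.
have LP : (fun t => Phi_star phi X nu (fun x => t * g x)%R) = conjugate L.
  by apply/funext => t; rewrite (conjugate_opt_lower_bound gphi dec Yg).
have KL : K = conjugate L.
  by rewrite -LP; apply/funext => t; rewrite (Phi_star_cumulant gphi dec t Yg).
split.
- by move=> e ie; rewrite KL; exact: biconjugate_interior.
- rewrite /strong_duality -/L.
  (* Strong duality at every point says exactly that [L] equals its biconjugate. *)
  have -> : (forall e : R, L e = ereal_sup [set (t * e)%:E -
      Phi_star phi X nu (fun x => t * g x)%R | t in [set: R]]) =
      (forall e, L e = conjugate (conjugate L) e) by rewrite -LP.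
  exact: biconjugate_lsc.
- by move=> /(biconjugate_lsc L0 cL) + e => /(_ e) ->; rewrite KL.
Qed.
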